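(* Let $\mathcal{B}_{\alpha}=\{\boldsymbol{\beta}: |\beta_i|\le i^{-\alpha},\ i\ge1\}$, let $\boldsymbol\beta\in\mathcal{B}_\alpha$, and suppose one observes $X_i=\beta_i+n^{-1/2}\varepsilon_i$, $i=1,2,\ldots$, with $\varepsilon_i$ i.i.d. $N(0,1)$. Suppose $3/4<\alpha<1$. Then an efficient estimator of $\theta=\sum_{i=1}^\infty\beta_i^2$ is given by $$\widehat\theta=\sum_{i\le m}\bigl(X_i^2-n^{-1}\bigr),$$ for $n^{1/(4\alpha-2)}<m\le n$.
   Context: White noise model in sequence form: for each $n$ the entire sequence $X_1,X_2,\ldots$ is observed, and asymptotics are as $n\to\infty$. Efficient means asymptotically efficient in the semiparametric sense: $\sqrt{n}(\widehat\theta-\theta)$ is asymptotically normal with mean $0$ and variance equal to the inverse of the semiparametric information for estimating $\theta$ in this model.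
   Formalization: The range n^{1/(4α-2)} < m ≤ n is read as m/n^{1/(4α-2)} → ∞ and m/n → 0; with the literal inequalities the claim fails, e.g. for m = n and β = 0, where √n·θ̂ tends to N(0,2) instead of variance 0. *)

(* Defs.v *)
From HB Require Import structures.
From mathcomp Require Import all_boot all_order all_algebra.
From mathcomp Require Import all_classical all_reals all_analysis.

Set Implicit Arguments.
Unset Strict Implicit.
Unset Printing Implicit Defensive.

Import Order.TTheory GRing.Theory Num.Theory.
Import numFieldNormedType.Exports.

Local Open Scope classical_set_scope.
Local Open Scope ring_scope.

(* Sequences are indexed from 0: [beta i] is the coefficient with 1-based index
   i + 1, so the bound on it reads (i + 1)^(-alpha). *)
Definition coef_class (R : realType) (alpha : R) : set (nat -> R) :=
  [set b | forall i, `|b i| <= i.+1%:R `^ (- alpha)].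

(* A limit in R. For alpha > 1/2 the series converges for every b in
   [coef_class alpha], so the default value of [limn] is never used there. *)
Definition theta (R : realType) (b : nat -> R) : R :=
  limn (series (fun i => b i ^+ 2)).

Definition mutually_independent d (T : measurableType d) (R : realType)
    (P : probability T R) (X : nat -> {RV P >-> R}) : Prop :=
  forall (s : seq nat) (A : nat -> set R), uniq s ->
    (forall i, measurable (A i)) ->
    P (\bigcap_(i in [set` s]) (X i @^-1` A i)) =
    (\prod_(i <- s) P (X i @^-1` A i))%E.

Definition iid_standard_normal d (T : measurableType d) (R : realType)
    (P : probability T R) (eps : nat -> {RV P >-> R}) : Prop :=
  mutually_independent eps /\
  (forall i (A : set R), measurable A ->
     distribution P (eps i) A = normal_prob 0 1 A).

Definition observation (R : realType) (T : Type) (n : nat) (b : nat -> R)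
    (eps : nat -> T -> R) (i : nat) (w : T) : R :=
  b i + (Num.sqrt n%:R)^-1 * eps i w.

Definition theta_hat (R : realType) (T : Type) (n m : nat)
    (X : nat -> T -> R) (w : T) : R :=
  \sum_(i < m) (X i w ^+ 2 - n%:R^-1).

(* The cutoff range n^(1/(4 alpha - 2)) < m <= n, read as a condition on orders
   of magnitude: n^(1/(4 alpha - 2)) << m << n. The pointwise inequalities are
   not enough, since sqrt n (theta_hat - theta) has variance
   4 \sum_(i < m) beta_i^2 + 2 m / n and, for beta_i = i^(-alpha), a bias of
   order sqrt n m^(1 - 2 alpha): the first condition makes the bias vanish and
   the second one the term 2 m / n.
   The first ratio has m in the numerator because x / 0 = 0. *)
Definition cutoff_range (R : realType) (alpha : R) (m : nat -> nat) : Prop :=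
  (m n)%:R / n%:R `^ (4 * alpha - 2)^-1 @[n --> \oo] --> +oo /\
  ((m n)%:R / n%:R : R) @[n --> \oo] --> (0 : R).

(* A one-dimensional regular submodel through beta is a curve t |-> b t in the
   class whose right derivative at 0, taken in l^2, is h. Curves are one-sided
   because beta may lie on the boundary of the class. *)
Definition regular_submodel (R : realType) (alpha : R) (beta : nat -> R)
    (b : R -> nat -> R) (h : nat -> R) : Prop :=
  [/\ b 0 = beta,
      \forall t \near (0 : R)^'+, coef_class alpha (b t),
      (\sum_(i <oo) (h i ^+ 2)%:E < +oo)%E &
      (\sum_(i <oo) (((b t i - beta i) / t - h i) ^+ 2)%:E)%E
        @[t --> (0 : R)^'+] --> 0%E].

Definition normal_score (R : realType) (sigma mu x : R) : R :=
  derive1 (fun u : R => ln (normal_pdf u sigma x)) mu.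

Definition normal_location_info (R : realType) (sigma mu : R) : \bar R :=
  (\int[normal_prob mu sigma]_x (normal_score sigma mu x ^+ 2)%:E)%E.

(* Fisher information at t = 0 of a submodel with derivative h, when the
   observations are independent with X_i distributed as N(b t i, 1/n): the
   score of X_i is h i times the location score, and by independence the
   information in the sequence is the sum of the coordinatewise ones. *)
Definition submodel_info (R : realType) (n : nat) (beta h : nat -> R) : \bar R :=
  (\sum_(i <oo) (h i ^+ 2)%:E *
     normal_location_info (Num.sqrt n%:R)^-1 (beta i))%E.

(* Information for theta at noise level 1/n: the infimum, over the regular
   submodels along which theta has a nonzero right derivative dtheta, of the
   information for theta in the submodel, I / dtheta^2. It is +oo, with inverse
   0, if there is no such submodel. *)
Definition semiparametric_info (R : realType) (alpha : R) (beta : nat -> R)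
    (n : nat) : \bar R :=
  ereal_inf [set x : \bar R | exists (b : R -> nat -> R) (h : nat -> R)
      (dtheta : R),
    [/\ regular_submodel alpha beta b h,
        ((theta (b t) - theta beta) / t) @[t --> (0 : R)^'+] --> dtheta,
        dtheta != 0 &
        x = (submodel_info n beta h * ((dtheta ^+ 2)^-1)%:E)%E]].

(* Convergence in distribution of Z n to N(0, V). The limit is taken as the law
   of sqrt V times a standard normal variable, so that V = 0 gives the point
   mass at 0; the library's [normal_prob 0 0] is the uniform law on [0, 1]. *)
Definition cvg_to_centered_normal (R : realType) (d : nat -> measure_display)
    (T : forall n, measurableType (d n)) (P : forall n, probability (T n) R)
    (Z : forall n, T n -> R) (V : R) : Prop :=
  forall f : R -> R, continuous f -> (exists M : R, forall x, `|f x| <= M) ->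
    (\int[P n]_w (f (Z n w))%:E)%E @[n --> \oo] -->
    (\int[normal_prob 0 1]_z (f (Num.sqrt V * z))%:E)%E.

(* The experiment indexed by n carries all the information of sample size n,
   hence the inverse information is V / n when V is the asymptotic variance of
   sqrt n (hat - theta). *)
Definition efficient (R : realType) (alpha : R) (beta : nat -> R)
    (d : nat -> measure_display) (T : forall n, measurableType (d n))
    (P : forall n, probability (T n) R) (hat : forall n, T n -> R) : Prop :=
  exists V : R,
    [/\ 0 <= V,
        forall n, (0 < n)%N ->
          ((semiparametric_info alpha beta n)^-1)%E = (V / n%:R)%:E &
        cvg_to_centered_normal P
          (fun n w => Num.sqrt n%:R * (hat n w - theta beta)) V].

(* Main.v *)
Require Import Defs.
From HB Require Import structures.
From mathcomp Require Import all_boot all_order all_algebra.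
From mathcomp Require Import all_classical all_reals all_analysis.
From mathcomp Require Import measurable_realfun.
From mathcomp Require Import ring lra.

(** With asymptotic variance [V = 4 * theta beta], the theorem has two halves.

    Information.  The score at coordinate [i] of a submodel with derivative [h]
    is [h i] times the location score of N(beta_i, 1/n), so the information of
    the submodel is [n * |h|^2] in l^2 norm ([submodel_infoE]).  Along the
    submodel theta = |b|^2 has derivative [2 <beta, h>], hence by
    Cauchy-Schwarz the information for theta is at least
    [n |h|^2 / (4 |beta|^2 |h|^2) = n / (4 theta)].  Equality holds for
    [h = - beta], which is the derivative of the curve [(1 - t) beta]; shrinking
    towards 0 does not leave the class, so this direction is always allowed.
    If [beta = 0], every derivative of theta vanishes, the infimum is over the
    empty set, and its inverse 0 agrees with [V = 0].  This is
    [inv_semiparametric_info].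

    Limit law.  Expanding the squares gives ([theta_hat_decomposition])
    [sqrt n (theta_hat - theta) = 2 \sum_(i < m) beta_i eps_i
       + n^(-1/2) \sum_(i < m) (eps_i^2 - 1) - sqrt n \sum_(i >= m) beta_i^2].
    The first sum is exactly normal with variance [4 \sum_(i < m) beta_i^2]
    ([integral_lin_comb]), which tends to V.  The second one has second moment of
    order [m / n] ([integral_sqr_centered_chi_square]) and vanishes because
    [m << n].  The bias is at most [sqrt n m^(1 - 2 alpha) / (2 alpha - 1)] and
    vanishes because [m >> n^(1 / (4 alpha - 2))] ([cvg_bias]).  A perturbation
    that tends to 0 in L^2 does not change the limit in distribution
    ([cvg_to_centered_normal_perturb]), even though the probability spaces change
    with n.

    That linear combinations of independent standard normal variables are normal
    is obtained by adding one variable at a time.  The product rule gives that a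
    partial sum is independent of the next variable ([lin_comb_indep]), Tonelli
    turns the expectation into a double integral, and the rotation invariance of
    the two-dimensional normal density evaluates it ([integral_normal_normal]). *)

Set Implicit Arguments.
Unset Strict Implicit.
Unset Printing Implicit Defensive.

Import Order.TTheory GRing.Theory Num.Theory.
Import numFieldNormedType.Exports.

Local Open Scope classical_set_scope.
Local Open Scope ring_scope.

(** * Integration against the normal law *)

Section density.
Context d (T : measurableType d) (R : realType).
Variables (mu nu : {measure set T -> \bar R}) (p : T -> R).
Hypotheses (mp : measurable_fun setT p) (p0 : forall x, 0 <= p x).
Hypothesis nuE : forall A, measurable A -> nu A = (\int[mu]_(x in A) (p x)%:E)%E.
Import HBNNSimple.

(** The identity is the hypothesis on [nu] when [f] is an indicator; simple
    functions and monotone convergence give the rest. *)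
Lemma ge0_integral_density (f : T -> \bar R) :
  measurable_fun setT f -> (forall x, (0 <= f x)%E) ->
  (\int[nu]_x f x = \int[mu]_x (f x * (p x)%:E))%E.
Proof.
move=> mf f0.
pose f_ := nnsfun_approx measurableT mf.
have f_cvg x : (EFin \o f_ ^~ x) n @[n --> \oo] --> f x.
  by apply: cvg_nnsfun_approx.
have f_nd x : {homo f_ ^~ x : n k / (n <= k)%N >-> n <= k}.
  by move=> n k nk; exact/lefP/nd_nnsfun_approx.
have mpE : measurable_fun setT (fun x => (p x)%:E) by exact/measurable_EFinP.
transitivity (limn (fun n => \int[nu]_x (f_ n x)%:E)%E).
  rewrite -monotone_convergence//.
  - by apply: eq_integral => x _; apply/esym/cvg_lim => //; exact: f_cvg.
  - by move=> n; apply/measurable_EFinP.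
  - by move=> n x _; rewrite lee_fin.
  - by move=> x _ n k nk; rewrite lee_fin; exact: f_nd.
transitivity (limn (fun n => \int[mu]_x ((f_ n x)%:E * (p x)%:E))%E); last first.
  rewrite -monotone_convergence//.
  - apply: eq_integral => x _; apply/cvg_lim => //.
    by apply: cvgeZr => //; exact: f_cvg.
  - by move=> n; apply: emeasurable_funM => //; apply/measurable_EFinP.
  - by move=> n x _; rewrite mule_ge0// lee_fin.
  - by move=> x _ n k nk; rewrite lee_wpmul2r ?lee_fin//; exact: f_nd.
congr (limn _); apply/funext => n.
transitivity (\sum_(k \in range (f_ n)) (k%:E * nu (f_ n @^-1` [set k])))%E.
  by rewrite integralT_nnsfun sintegralE.
transitivity (\int[mu]_x (\sum_(k \in range (f_ n))
    ((k * \1_(f_ n @^-1` [set k]) x)%:E * (p x)%:E)))%E; last first.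
  apply: eq_integral => x _.
  rewrite [in RHS]fimfunE -fsumEFin//.
  rewrite ge0_mule_fsuml//.
  by move=> k; rewrite nnfun_muleindic_ge0.
rewrite ge0_integral_fsum//; last 2 first.
- move=> k; apply: emeasurable_funM => //; apply/measurable_EFinP.
  by apply: measurable_funM.
- move=> k x _; rewrite mule_ge0 ?lee_fin//.
  exact: nnfun_muleindic_ge0.
apply: eq_fsbigr => k /[!inE]/= -[x _ <-].
under [RHS]eq_integral do rewrite EFinM -muleA.
rewrite ge0_integralZl//; last 3 first.
- by apply: emeasurable_funM => //; apply/measurable_EFinP.
- by move=> y _; rewrite mule_ge0 ?lee_fin.
- by rewrite lee_fin.
congr (_ * _)%E.
rewrite nuE// integral_mkcond; apply: eq_integral => y _.
by rewrite patchE indicE; case: ifPn => _; rewrite ?mul1e ?mul0e.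
Qed.

End density.

Section normal_integral.
Variable R : realType.
Local Notation mu := (@lebesgue_measure R).

Lemma ge0_integral_normal_prob (m s : R) (f : R -> \bar R) :
  measurable_fun [set: R] f -> (forall x, (0 <= f x)%E) ->
  (\int[normal_prob m s]_x f x = \int[mu]_x (f x * (normal_pdf m s x)%:E))%E.
Proof.
move=> mf f0; apply: ge0_integral_density => //.
- exact: measurable_normal_pdf.
- by move=> x; exact: normal_pdf_ge0.
Qed.

End normal_integral.

Section affine_substitution.
Variable R : realType.
Implicit Types (f g : R -> R) (a c s x y : R).
Local Notation mu := (@lebesgue_measure R).

Lemma integral_lebesgueN f : continuous f -> (forall x, 0 <= f x) ->
  (\int[mu]_x (f x)%:E = \int[mu]_x (f (- x))%:E)%E.
Proof.
move=> cf f0.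
have mf : measurable_fun [set: R] (EFin \o f).
  by apply/measurable_EFinP; exact: continuous_measurable_fun.
transitivity (\int[pushforward mu (-%R : R -> measurableTypeR R)]_x (f x)%:E)%E.
  by apply: eq_measure_integral => A mA _; exact/esym/lebesgue_measureN.
by rewrite ge0_integral_pushforward//= => [x _]; rewrite lee_fin.
Qed.

Lemma integral_affine f a c : 0 < a -> continuous f -> (forall x, 0 <= f x) ->
  (\int[mu]_x (f x)%:E = \int[mu]_x (f (a * x + c) * a)%:E)%E.
Proof.
move=> a0 cf f0.
pose F x := a * x + c.
have F' : F^`()%classic = cst a.
  apply/funext => x; rewrite /F derive1E deriveD// deriveM// derive_cst derive_id.
  by rewrite derive_cst addr0 scaler0 addr0 scaler1.
rewrite (@increasing_ge0_integration_by_substitutionT _ F)//.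
- by apply: eq_integral => x _; rewrite F'.
- by move=> x y xy; rewrite /F ltrD2r ltr_pM2l.
- by rewrite F' => ?; exact: cvg_cst.
- by rewrite F'; exact: is_cvg_cst.
- by rewrite F'; exact: is_cvg_cst.
- apply: (cvg_comp (fun x => a * x) (fun x => x + c)).
    exact: gt0_cvgMrNy.
  exact: cvg_addrr_Ny.
- apply: (cvg_comp (fun x => a * x) (fun x => x + c)).
    exact: gt0_cvgMry.
  exact: cvg_addrr.
Qed.

End affine_substitution.

(** * Moments of the standard normal law and the location information *)

Section second_moment.
Variable R : realType.
Implicit Types (f g : R -> R) (a c s x y : R).
Local Notation mu := (@lebesgue_measure R).
Local Notation phi := (@normal_pdf R 0 1).

Lemma std_normal_pdfE : phi = fun x => normal_peak 1 * expR (- (x ^+ 2 / 2)).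
Proof.
apply/funext => x; rewrite normal_pdfE ?oner_neq0// /normal_fun subr0.
by rewrite mulNr expr1n.
Qed.

Let is_derive_std_normal_pdf x : is_derive x 1 phi (- (x * phi x)).
Proof.
rewrite std_normal_pdfE; apply: is_derive_eq.
rewrite !scaler0 ?addr0 ?add0r /GRing.scale/=.
by field.
Qed.

Let cvg_id_std_normal_pdf : (fun n : nat => n%:R * phi n%:R) @ \oo --> (0 : R).
Proof.
have phi_le (n : nat) : n%:R * phi n%:R <= 4 * normal_peak 1 * n.+1%:R^-1.
  rewrite std_normal_pdfE expRN mulrCA [4 * _]mulrC -[leRHS]mulrA.
  rewrite ler_pM2l ?normal_peak_gt0 ?oner_neq0//.
  rewrite ler_pdivrMr ?expR_gt0//.
  rewrite mulrAC ler_pdivlMr ?ltr0n//.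
  rewrite -natr1; have := expR_ge1Dx ((n%:R : R) ^+ 2 / 2).
  have := ler0n R n; set y := expR _; set z := n%:R => z0 yz; nra.
apply: (@squeeze_cvgr _ _ _ _ (cst 0) (fun n => 4 * normal_peak 1 * n.+1%:R^-1)).
- by near=> n; rewrite phi_le mulr_ge0// normal_pdf_ge0.
- exact: cvg_cst.
- rewrite -[X in _ --> X](mulr0 (4 * @normal_peak R 1)).
  by apply: cvgM; [exact: cvg_cst|exact: cvg_harmonic].
Unshelve. all: by end_near.
Qed.

(** Since [phi' = - x phi], integrating [x * (x phi)] by parts over [[0, n]]
    gives the integral of [phi] up to the boundary term [n phi(n)], and both
    integrands are even. *)
Lemma std_normal_second_moment : (\int[normal_prob (0 : R) 1]_x (x ^+ 2)%:E = 1)%E.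
Proof.
have cphi : continuous phi by apply: continuous_normal_pdf; exact: oner_neq0.
have phi0 := normal_pdf_ge0 0 (1 : R).
have cid2phi : continuous (fun x => x ^+ 2 * phi x).
  by move=> x; apply: cvgM; [exact: exprn_continuous|exact: cphi].
have id2phi0 x : 0 <= x ^+ 2 * phi x by rewrite mulr_ge0// sqr_ge0.
rewrite ge0_integral_normal_prob; last 2 first.
- by apply/measurable_EFinP; exact: measurable_funX.
- by move=> x; rewrite lee_fin sqr_ge0.
rewrite -(integral_normal_pdf 0 (1 : R)).
under eq_integral do rewrite -EFinM.
rewrite !ge0_symfun_integralT//; last 2 first.
- by move=> x; rewrite std_normal_pdfE/= sqrrN.
- by move=> x; rewrite std_normal_pdfE/= sqrrN.
congr (_ * _)%E.
have -> : [set x : R | 0 <= x] = `[0, +oo[%classic.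
  by apply/seteqP; split => x/=; rewrite in_itv/= andbT.
have cvgl := @ge0_cvgn_integral R mu _ id2phi0 (continuous_measurable_fun cid2phi).
have cvgr := @ge0_cvgn_integral R mu _ phi0 (continuous_measurable_fun cphi).
apply: (cvg_unique _ cvgl) => //.
rewrite /= -[X in _ --> X]add0e.
have IBP (n : nat) : (0 < n)%N -> (\int[mu]_(x in `[0%R, n%:R]) (x ^+ 2 * phi x)%:E =
   (- (n%:R * phi n%:R))%:E + \int[mu]_(x in `[0%R, n%:R]) (phi x)%:E)%E.
  move=> n0.
  under [in LHS]eq_integral do rewrite expr2 -mulrA.
  have := @integration_by_parts R id (fun x => - phi x) (cst 1) (fun x => x * phi x) 0 n%:R.
  rewrite ltr0n => /(_ n0).
  have cin (h : R -> R) : continuous h -> {within `[0, n%:R], continuous h}.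
    by move=> ch; exact: continuous_subspaceT.
  have din (h : R -> R) : (forall x, derivable h x 1) -> derivable_oo_LRcontinuous h 0 n%:R.
    move=> dh; have ch x : {for x, continuous h}.
      exact/differentiable_continuous/derivable1_diffP/dh.
    split => [x _| |]; first exact: dh.
    - exact/cvg_at_right_filter/ch.
    - exact/cvg_at_left_filter/ch.
  have dNphi x : is_derive x 1 (fun x => - phi x) (x * phi x).
    rewrite -[x * _]opprK; exact: is_deriveN.
  move=> ->.
  - rewrite mul0r subr0 mulrN; congr (_ + _)%E.
    under eq_integral do rewrite mul1r EFinN.
    by rewrite integral_ge0N ?oppeK// => x _; rewrite lee_fin.
  - by apply: cin; exact: cst_continuous.
  - by apply: din => x; exact: derivable_id.
  - by move=> x _; rewrite derive1_id.
  - by apply: cin => x; apply: cvgM; [exact: cvg_id|exact: cphi].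
  - by apply: din => x; exact: ex_derive.
  - by move=> x _; rewrite derive1E; exact: derive_val.
apply: (@cvg_trans _ ((fun n : nat => (- (n%:R * phi n%:R))%:E +
    \int[mu]_(x in `[0%R, n%:R]) (phi x)%:E)%E @ \oo)).
  apply: near_eq_cvg; near=> n.
  by rewrite IBP//; near: n; exact: nbhs_infty_gt.
apply: cvgeD => //.
apply/fine_cvgP; split; first by near=> n.
by have /= := cvgN cvg_id_std_normal_pdf; rewrite oppr0; exact.
Unshelve. all: by end_near.
Qed.

End second_moment.

Section location_info.
Variable R : realType.
Implicit Types (f g : R -> R) (a c m s x y : R).
Local Notation mu := (@lebesgue_measure R).
Local Notation phi := (@normal_pdf R 0 1).

(** Finiteness follows without computing the moment: x^4 is dominated by a
    multiple of exp(x^2 / 4), which turns the density of N(0, 1) into a multiple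
    of the one of N(0, 2), of integral 1. *)
Lemma std_normal_fourth_moment_lty :
  (\int[normal_prob (0 : R) 1]_x (x ^+ 4)%:E < +oo)%E.
Proof.
have s2 : Num.sqrt 2 != 0 :> R by rewrite gt_eqF// sqrtr_gt0.
pose C : R := 64 * normal_peak 1 / normal_peak (Num.sqrt 2).
have p2 : 0 < normal_peak (Num.sqrt 2) :> R := normal_peak_gt0 s2.
have p1 : 0 < normal_peak 1 :> R := normal_peak_gt0 (oner_neq0 _).
rewrite ge0_integral_normal_prob; last 2 first.
- by apply/measurable_EFinP; exact: measurable_funX.
- by move=> x; rewrite lee_fin exprn_even_ge0.
apply: (@le_lt_trans _ _ (\int[mu]_x (C%:E * (normal_pdf 0 (Num.sqrt 2) x)%:E))%E).
  apply: ge0_le_integral => //.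
  - by move=> x _; rewrite mule_ge0// lee_fin ?exprn_even_ge0// normal_pdf_ge0.
  - apply: emeasurable_funM; apply/measurable_EFinP; first exact: measurable_funX.
    exact: measurable_normal_pdf.
  - apply: emeasurable_funM => //; apply/measurable_EFinP.
    exact: measurable_normal_pdf.
  move=> x _; rewrite -!EFinM lee_fin std_normal_pdfE normal_pdfE// /normal_fun subr0.
  rewrite [leRHS](_ : _ = 64 * normal_peak 1 *
    expR (- x ^+ 2 / (Num.sqrt 2 ^+ 2 *+ 2))); last first.
    by rewrite mulrA mulfVK// gt_eqF.
  rewrite -[_ * _ * expR _]mulrA [64 * _]mulrC -[leRHS]mulrA mulrCA ler_pM2l//.
  (* With E = exp(x^2 / 8) the three exponentials are powers of E, and
     1 + x^2 / 8 <= E bounds x^4 by 64 E^2. *)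
  set E := expR (x ^+ 2 / 8).
  have E0 : 0 < E := expR_gt0 _.
  have xE : x ^+ 2 <= 8 * E.
    have := expR_ge1Dx (x ^+ 2 / 8); rewrite -/E; lra.
  rewrite sqr_sqrtr// (_ : - x ^+ 2 / (2 *+ 2) = - (2%:R * (x ^+ 2 / 8))); last by field.
  rewrite (_ : x ^+ 2 / 2 = 4%:R * (x ^+ 2 / 8)); last by field.
  rewrite !expRN !expRM_natl -!/E.
  rewrite ler_pdivrMr ?exprn_gt0// (_ : E ^- 2 * 64 * E ^+ 4 = 64 * E ^+ 2); last first.
    by field; rewrite gt_eqF.
  rewrite (_ : x ^+ 4 = (x ^+ 2) ^+ 2) -?exprM//.
  have := sqr_ge0 x; nra.
rewrite ge0_integralZl//.
- by rewrite integral_normal_pdf mule1 ltry.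
- by apply/measurable_EFinP; exact: measurable_normal_pdf.
- by move=> x _; rewrite lee_fin normal_pdf_ge0.
- by rewrite lee_fin /C mulr_ge0 ?invr_ge0 ?normal_peak_ge0// mulr_ge0 ?normal_peak_ge0.
Qed.

Lemma normal_peak_scale s : 0 < s -> normal_peak s * s = normal_peak 1 :> R.
Proof.
move=> s0; rewrite /normal_peak expr1n mul1r -mulrnAr sqrtrM ?sqr_ge0//.
by rewrite sqrtr_sqr gtr0_norm// invfM mulrAC mulVf ?mul1r// gt_eqF.
Qed.

Lemma normal_pdf_affine m s x : 0 < s ->
  normal_pdf m s (s * x + m) * s = phi x.
Proof.
move=> s0; have sN0 : s != 0 by rewrite gt_eqF.
rewrite normal_pdfE// std_normal_pdfE mulrAC normal_peak_scale//.
by rewrite /normal_fun addrK; congr (_ * expR _); field.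
Qed.

Lemma normal_scoreE s m x : 0 < s -> normal_score s m x = (x - m) / s ^+ 2.
Proof.
move=> s0; have sN0 : s != 0 by rewrite gt_eqF.
rewrite /normal_score (_ : (fun u => _) =
    fun u => ln (normal_peak s) + - (x - u) ^+ 2 / (s ^+ 2 *+ 2)); last first.
  apply/funext => u; rewrite normal_pdfE// lnM ?posrE ?expR_gt0 ?normal_peak_gt0//.
  by rewrite expRK.
rewrite derive1E; apply: derive_val; apply: is_derive_eq.
rewrite /GRing.scale/=; field.
by [].
Qed.

Lemma normal_location_infoE s m : 0 < s ->
  normal_location_info s m = (s ^- 2)%:E.
Proof.
move=> s0; have sN0 : s != 0 by rewrite gt_eqF.
rewrite /normal_location_info.
have cpdf := @continuous_normal_pdf _ m _ sN0.
have csc : continuous (fun x => normal_score s m x ^+ 2).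
  rewrite (_ : (fun x => _) = fun x => ((x - m) / s ^+ 2) ^+ 2).
    move=> x; apply: (@continuous_comp _ _ _ (fun x => (x - m) / s ^+ 2)
      (fun x => x ^+ 2)); last exact: exprn_continuous.
    by apply: cvgM; [apply: cvgB; [exact: cvg_id|exact: cvg_cst]|exact: cvg_cst].
  by apply/funext => x; rewrite normal_scoreE.
rewrite ge0_integral_normal_prob; last 2 first.
- by apply/measurable_EFinP; exact: continuous_measurable_fun.
- by move=> x; rewrite lee_fin sqr_ge0.
under eq_integral do rewrite -EFinM.
rewrite (@integral_affine _ _ s m)//; last 2 first.
- by move=> x; apply: cvgM; [exact: csc|exact: cpdf].
- by move=> x; rewrite mulr_ge0 ?sqr_ge0 ?normal_pdf_ge0.
rewrite -[RHS]mule1 -std_normal_second_moment ge0_integral_normal_prob; last 2 first.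
- by apply/measurable_EFinP; exact: measurable_funX.
- by move=> x; rewrite lee_fin sqr_ge0.
rewrite -ge0_integralZl//; last 3 first.
- apply: emeasurable_funM; apply/measurable_EFinP; first exact: measurable_funX.
  exact: measurable_normal_pdf.
- by move=> x _; rewrite mule_ge0// lee_fin ?sqr_ge0// normal_pdf_ge0.
- by rewrite lee_fin invr_ge0 sqr_ge0.
apply: eq_integral => x _.
rewrite -mulrA normal_pdf_affine// normal_scoreE// addrK.
by rewrite -!EFinM; congr (_%:E); field.
Qed.

End location_info.

(** * Rotation invariance of the normal law *)

Section gauss_convolution.
Variable R : realType.
Implicit Types (f g : R -> R) (a c m r s t u x y z : R).
Local Notation mu := (@lebesgue_measure R).
Local Notation phi := (@normal_pdf R 0 1).
Local Notation N01 := (normal_prob (0 : R) 1).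

Lemma continuous_affine_comp f a c : continuous f -> continuous (fun x => f (a * x + c)).
Proof.
move=> cf x; apply: (@continuous_comp _ _ _ (fun x => a * x + c) f); last exact: cf.
apply: cvgD; last exact: cvg_cst.
by apply: cvgM; [exact: cvg_cst|exact: cvg_id].
Qed.

(** If [r^2 = s^2 + a^2] and [r u = s z + a y], then
    [z^2 + y^2 = u^2 + (r / s)^2 (y - a u / r)^2]: given [u], the variable [y] is
    again normal. *)
Lemma std_normal_pdf_rotation s a r u y : 0 < s -> 0 < r ->
  r ^+ 2 = s ^+ 2 + a ^+ 2 ->
  phi (r / s * u - a / s * y) * phi y * (r / s) =
  phi u * normal_pdf (a / r * u) (s / r) y.
Proof.
move=> s0 r0 rsa; have sN0 : s != 0 by rewrite gt_eqF.
have rN0 : r != 0 by rewrite gt_eqF.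
have sr0 : 0 < s / r by rewrite divr_gt0.
rewrite (normal_pdfE _ (lt0r_neq0 sr0)) std_normal_pdfE/= /normal_fun.
rewrite -(normal_peak_scale sr0).
set p := normal_peak _.
rewrite [LHS](_ : _ = p ^+ 2 * (s / r) *
  (expR (- ((r / s * u - a / s * y) ^+ 2 / 2)) * expR (- (y ^+ 2 / 2))));
  last by field; rewrite sN0 rN0.
rewrite [RHS](_ : _ = p ^+ 2 * (s / r) * (expR (- (u ^+ 2 / 2)) *
  expR (- (y - a / r * u) ^+ 2 / ((s / r) ^+ 2 *+ 2)))); last by ring.
congr (_ * _); rewrite -!expRD; congr expR.
(* Inserting the factor (r^2 - a^2) / s^2 = 1 leaves an identity of rational
   functions in which r, s and a are unrelated. *)
have rsE t : t ^+ 2 = (r ^+ 2 - a ^+ 2) / s ^+ 2 * t ^+ 2.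
  by rewrite rsa addrK mulfV ?mul1r// expf_neq0.
rewrite (rsE u) (rsE y).
by field; rewrite sN0 rN0.
Qed.

(** Substituting [z = (r u - a y) / s] and exchanging the integrals leaves, for
    fixed [u], the total mass of the conditional normal density of [y]. *)
Lemma integral_normal_normal f s a : 0 <= s -> continuous f -> (forall x, 0 <= f x) ->
  (\int[N01]_y \int[N01]_z (f (s * z + a * y))%:E =
   \int[N01]_u (f (Num.sqrt (s ^+ 2 + a ^+ 2) * u))%:E)%E.
Proof.
move=> s_ge0 cf f0.
have cphi : continuous phi by apply: continuous_normal_pdf; exact: oner_neq0.
have phi0 := normal_pdf_ge0 0 (1 : R).
have mf : measurable_fun setT f := continuous_measurable_fun cf.
have mphi : measurable_fun setT phi := continuous_measurable_fun cphi.
have cfa b e : continuous (fun x => f (b * x + e)) by exact: continuous_affine_comp.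
have cfl b : continuous (fun x => f (b * x)).
  by rewrite (_ : (fun x => _) = fun x => f (b * x + 0))//; apply/funext => x; rewrite addr0.
have int01 g : continuous g -> (forall x, 0 <= g x) ->
    (\int[N01]_y (g y)%:E = \int[mu]_y (g y * phi y)%:E)%E.
  move=> cg g0; rewrite ge0_integral_normal_prob//.
  by apply/measurable_EFinP; exact: continuous_measurable_fun.
move: s_ge0; rewrite le_eqVlt => /predU1P[<-|s0].
  (* For s = 0 there is no substitution to make; only the sign of a has to be
     removed, by the symmetry of phi. *)
  rewrite expr0n add0r sqrtr_sqr.
  under eq_integral => y _.
    under eq_integral do rewrite mul0r add0r.
    rewrite integral_cst// [X in (_ * X)%E](_ : _ = 1%E) ?mule1;
      last exact: (@probability_setT _ _ _ N01).
    over.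
  have [a0|a0] := ger0P a; first by [].
  rewrite !int01// integral_lebesgueN//; last 2 first.
  - by move=> x; apply: cvgM; [exact: cfl|exact: cphi].
  - by move=> x; rewrite mulr_ge0.
  by apply: eq_integral => x _; rewrite mulrN mulNr std_normal_pdfE sqrrN.
set r := Num.sqrt _.
have r2 : r ^+ 2 = s ^+ 2 + a ^+ 2 by rewrite sqr_sqrtr// addr_ge0// sqr_ge0.
have r0 : 0 < r by rewrite sqrtr_gt0 ltr_wpDr ?sqr_ge0// exprn_gt0.
have sN0 : s != 0 by rewrite gt_eqF.
have rs0 : 0 < r / s by rewrite divr_gt0.
pose h (yu : R * R) := f (r * yu.2) * (phi (r / s * yu.2 - a / s * yu.1) * phi yu.1 * (r / s)).
have h0 yu : 0 <= h yu by rewrite /h mulr_ge0 ?f0// mulr_ge0 ?(ltW rs0)// mulr_ge0 ?phi0.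
have mh : measurable_fun setT h.
  apply: measurable_funM.
    apply: (measurableT_comp mf).
    by apply: measurable_funM => //; exact: measurable_snd.
  apply: measurable_funM => //; apply: measurable_funM.
    apply: (measurableT_comp mphi).
    apply: measurable_funB; first by apply: measurable_funM => //; exact: measurable_snd.
    by apply: measurable_funM => //; exact: measurable_fst.
  by apply: (measurableT_comp mphi); exact: measurable_fst.
have inner y : (\int[N01]_z (f (s * z + a * y))%:E * (phi y)%:E = \int[mu]_u (h (y, u))%:E)%E.
  rewrite int01//.
  rewrite (@integral_affine _ _ (r / s) (- (a / s * y)))//; last 2 first.
  - by move=> x; apply: cvgM; [exact: cfa|exact: cphi].
  - by move=> x; rewrite mulr_ge0.
  rewrite -ge0_integralZr//; last 3 first.
  - apply/measurable_EFinP; apply: measurable_funM => //.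
    apply: continuous_measurable_fun.
    apply: (@continuous_affine_comp (fun x => f (s * x + a * y) * phi x)) => x.
    by apply: cvgM; [exact: cfa|exact: cphi].
  - by move=> x _; rewrite lee_fin mulr_ge0 ?(ltW rs0)// mulr_ge0.
  - by rewrite lee_fin.
  apply: eq_integral => u _; rewrite -EFinM /h/=; congr (_%:E).
  rewrite (_ : s * _ + _ = r * u); last by field.
  by ring.
rewrite ge0_integral_normal_prob; last 2 first.
- apply: (@measurable_fun_fubini_tonelli_G _ _ _ _ R N01 (fun zy => (f (s * zy.1 + a * zy.2))%:E)).
    apply/measurable_EFinP; apply: (measurableT_comp mf).
    by apply: measurable_funD; apply: measurable_funM.
  by move=> zy; rewrite lee_fin.
- by move=> y; apply: integral_ge0 => z _; rewrite lee_fin.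
under eq_integral do rewrite inner.
rewrite (@fubini_tonelli _ _ _ _ R mu mu (fun yu => (h yu)%:E)); last 2 first.
- exact/measurable_EFinP.
- by move=> yu; rewrite lee_fin.
rewrite int01//; apply: eq_integral => u _.
rewrite /h/=.
under eq_integral do rewrite (std_normal_pdf_rotation _ _ s0 r0 r2) mulrA EFinM.
rewrite ge0_integralZl//.
- by rewrite integral_normal_pdf mule1.
- by apply/measurable_EFinP; exact: measurable_normal_pdf.
- by move=> x _; rewrite lee_fin normal_pdf_ge0.
- by rewrite lee_fin mulr_ge0.
Qed.

End gauss_convolution.

(** * Joint laws of independent variables *)

Section independence.
Context d (T : measurableType d) (R : realType) (P : probability T R).

(** Both sides are finite measures in [C] that agree on rectangles.  Keeping
    an independent event [E] in the statement lets the independence of all later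
    variables be carried through an induction on partial sums. *)
Lemma joint_law_event (X Y : {mfun T >-> R}) (E : set T) : measurable E ->
  (forall A B : set R, measurable A -> measurable B ->
    P (X @^-1` A `&` Y @^-1` B `&` E) = (P (X @^-1` A) * P (Y @^-1` B) * P E)%E) ->
  forall C : set (R * R), measurable C ->
    P ((fun w => (X w, Y w)) @^-1` C `&` E) =
    ((distribution P X \x distribution P Y) C * P E)%E.
Proof.
move=> mE PXYE C mC.
have mXY : measurable_fun setT (fun w => (X w, Y w)) by apply: measurable_fun_pair.
pose c : {nonneg R} := NngNum (fine_ge0 (measure_ge0 P E)).
have cE : c%:num%:E = P E by rewrite /= fineK// fin_num_measure.
pose m1 := measure_function_pushforward__canonical__measure_function_Measure (mrestr P mE) mXY.
pose m2 : {measure set (R * R) -> \bar R} := mscale c (distribution P X \x distribution P Y)%E.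
pose mX : {finite_measure set R -> \bar R} := mscale c (distribution P X).
transitivity ((mX \x distribution P Y)%E C).
  apply/esym/(@product_measure_unique _ _ _ _ _ mX (distribution P Y) m1) => // A B mA mB.
  transitivity (P (X @^-1` A `&` Y @^-1` B `&` E)) => //.
  by rewrite PXYE// /mX/= /mscale cE muleC muleA.
transitivity (m2 C); last by rewrite /m2/= /mscale cE muleC.
apply: (@product_measure_unique _ _ _ _ _ mX (distribution P Y) m2) => // A B mA mB.
by rewrite /m2/= /mscale/= product_measure1E// muleA.
Qed.

Lemma joint_law (X Y : {mfun T >-> R}) :
  (forall A B : set R, measurable A -> measurable B ->
    P (X @^-1` A `&` Y @^-1` B) = (P (X @^-1` A) * P (Y @^-1` B))%E) ->
  forall C : set (R * R), measurable C ->
    P ((fun w => (X w, Y w)) @^-1` C) =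
    (distribution P X \x distribution P Y)%E C.
Proof.
move=> PXY C mC; rewrite -[LHS]/(P _) -[X in P X]setIT joint_law_event//.
  by rewrite probability_setT mule1.
by move=> A B mA mB; rewrite setIT PXY// probability_setT mule1.
Qed.

Lemma ge0_integral_joint_law (X Y : {mfun T >-> R}) (h : R * R -> \bar R) :
  (forall A B : set R, measurable A -> measurable B ->
    P (X @^-1` A `&` Y @^-1` B) = (P (X @^-1` A) * P (Y @^-1` B))%E) ->
  measurable_fun setT h -> (forall z, (0 <= h z)%E) ->
  (\int[P]_w h (X w, Y w) =
   \int[P]_v \int[P]_w h (X w, Y v))%E.
Proof.
move=> PXY mh h0.
have mXY : measurable_fun setT (fun w => (X w, Y w)) by apply: measurable_fun_pair.
transitivity (\int[pushforward P (fun w => (X w, Y w))]_z h z)%E.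
  by rewrite ge0_integral_pushforward// => z _; exact: h0.
transitivity (\int[distribution P X \x distribution P Y]_z h z)%E.
  rewrite (@eq_measure_integral _ _ _ _ (distribution P X \x distribution P Y)%E
    (measure_function_pushforward__canonical__measure_function_Measure P mXY))//.
  by move=> C mC _; exact: joint_law.
rewrite fubini_tonelli2// ge0_integral_distribution//; last 2 first.
- exact: measurable_fun_fubini_tonelli_G.
- by move=> y; apply: integral_ge0.
apply: eq_integral => v _; rewrite /fubini_G/= ge0_integral_distribution//.
apply: (measurableT_comp mh).
by apply: measurable_fun_pair.
Qed.

End independence.

(** * Linear combinations of independent standard normal variables *)

Section independent_normals.
Context d (T : measurableType d) (R : realType) (P : probability T R).
Variable eps : nat -> {RV P >-> R}.
Hypothesis eps_iid : iid_standard_normal eps.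
Implicit Types (a : nat -> R) (k : nat) (f g : R -> R).
Local Notation N01 := (normal_prob (0 : R) 1).

Definition lin_comb a k (w : T) : R := \sum_(i < k) a i * eps i w.

Lemma measurable_lin_comb a k : measurable_fun setT (lin_comb a k).
Proof.
rewrite /lin_comb; apply: measurable_sum => i.
by apply: measurable_funM.
Qed.

HB.instance Definition _ a k :=
  isMeasurableFun.Build _ _ _ _ (lin_comb a k) (measurable_lin_comb a k).

Lemma ge0_integral_eps i (g : R -> \bar R) :
  measurable_fun setT g -> (forall x, (0 <= g x)%E) ->
  (\int[P]_w g (eps i w) = \int[N01]_z g z)%E.
Proof.
move=> mg g0.
(* The law of eps i has to be formed on the measurable type that carries
   normal_prob, whose display differs from the default one of R. *)
have mX : measurable_fun setT (eps i : T -> measurableTypeR R).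
  by move=> mT A mA; exact: (@measurable_funPT _ _ _ _ (eps i) mT A mA).
transitivity (\int[pushforward P (eps i : T -> measurableTypeR R)]_z g z)%E.
  by rewrite ge0_integral_pushforward.
rewrite (@eq_measure_integral _ _ _ setT N01
  (measure_function_pushforward__canonical__measure_function_Measure P mX))//.
by move=> A mA _; exact: eps_iid.2.
Qed.

(** In the induction step the rectangles of the pair made of the partial sum and
    [eps k], intersected with an event on the later variables, are covered by the
    induction hypothesis for the list [k :: s]; hence the pair is independent of
    that event, and so is the next partial sum, a function of the pair. *)
Lemma lin_comb_indep a k (B : set R) (s : seq nat) (A : nat -> set R) :
  measurable B -> uniq s -> all (leq k) s -> (forall i, measurable (A i)) ->
  P (lin_comb a k @^-1` B `&` \bigcap_(i in [set` s]) (eps i @^-1` A i)) =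
  (P (lin_comb a k @^-1` B) * \prod_(i <- s) P (eps i @^-1` A i))%E.
Proof.
have [indep _] := eps_iid.
have mcap r (A' : nat -> set R) : (forall i, measurable (A' i)) ->
    measurable (\bigcap_(i in [set` r]) (eps i @^-1` A' i)).
  by move=> mA'; apply: bigcap_measurableType => i _; exact: measurable_funPTI.
elim: k B s A => [|k IH] B s A mB us ks mA.
  have [B0|B0] := pselect (B 0).
    rewrite (_ : _ @^-1` _ = setT); last first.
      by apply/seteqP; split => // w _; rewrite /preimage/= /lin_comb big_ord0.
    by rewrite setTI probability_setT mul1e indep.
  rewrite (_ : _ @^-1` _ = set0); last first.
    by apply/seteqP; split => // w; rewrite /preimage/= /lin_comb big_ord0.
  by rewrite set0I measure0 mul0e.
have prod_event (r : seq nat) : uniq r -> all (leq k.+1) r -> forall A' : nat -> set R,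
    (forall i, measurable (A' i)) -> forall B1 B2 : set R, measurable B1 -> measurable B2 ->
    P (lin_comb a k @^-1` B1 `&` eps k @^-1` B2 `&` \bigcap_(i in [set` r]) (eps i @^-1` A' i)) =
    (P (lin_comb a k @^-1` B1) * P (eps k @^-1` B2) *
     P (\bigcap_(i in [set` r]) (eps i @^-1` A' i)))%E.
  move=> ur kr A' mA' B1 B2 mB1 mB2.
  have krk : all (leq k) r by apply: sub_all kr => i; exact: ltnW.
  have kNr : k \notin r by apply/negP => /(allP kr); rewrite ltnn.
  (* Apply the induction hypothesis with B2 as the constraint on eps k. *)
  pose A2 i := if i == k then B2 else A' i.
  have A2r i : i \in r -> A2 i = A' i.
    by rewrite /A2; case: eqP => // -> kr'; rewrite kr' in kNr.
  have mA2 i : measurable (A2 i) by rewrite /A2; case: ifP.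
  have := IH B1 (k :: r) A2 mB1.
  rewrite /= kNr ur leqnn krk => /(_ isT isT mA2).
  rewrite big_cons {2}/A2 eqxx muleA (eq_big_seq (fun i => P (eps i @^-1` A' i))); last first.
    by move=> i ir; rewrite A2r.
  rewrite -indep// => <-; congr (P _).
  rewrite -setIA; congr (_ `&` _); apply/seteqP; split => w /=.
    move=> [wk wr] i /=; rewrite inE => /predU1P[->|ir]; first by rewrite /A2 eqxx.
    by rewrite /= A2r//; exact: wr.
  move=> wA; split; first by have := wA k (mem_head _ _); rewrite /= /A2 eqxx.
  by move=> i /= ir; have := wA i; rewrite /= inE ir orbT A2r//; exact.
pose C : set (R * R) := [set xy | B (xy.1 + a k * xy.2)].
have mC : measurable C.
  rewrite -[C]setTI; apply: (_ : measurable_fun setT (fun xy : R * R => xy.1 + a k * xy.2)) => //.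
  apply: measurable_funD; first exact: measurable_fst.
  by apply: measurable_funM => //; exact: measurable_snd.
rewrite -indep//.
have -> : lin_comb a k.+1 @^-1` B = (fun w => (lin_comb a k w, eps k w)) @^-1` C.
  by rewrite /lin_comb; apply/funext => w; rewrite /preimage/= big_ord_recr.
rewrite joint_law_event; first last.
- exact: mC.
- by move=> B1 B2 mB1 mB2; exact: prod_event.
- exact: mcap.
rewrite joint_law// => B1 B2 mB1 mB2.
have := prod_event [::] isT isT A mA B1 B2 mB1 mB2.
rewrite (_ : \bigcap_(i in _) _ = setT); last by apply/seteqP; split.
by rewrite setIT probability_setT mule1.
Qed.

(** A linear combination has the law of its standard deviation times a standard
    normal variable.  Nonnegative continuous test functions suffice, and this
    class is stable under the translations met in the induction. *)
Lemma integral_lin_comb a k f : continuous f -> (forall x, 0 <= f x) ->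
  (\int[P]_w (f (lin_comb a k w))%:E =
   \int[N01]_z (f (Num.sqrt (\sum_(i < k) a i ^+ 2) * z))%:E)%E.
Proof.
elim: k f => [|k IH] f cf f0.
  under eq_integral do rewrite /lin_comb big_ord0.
  under [RHS]eq_integral do rewrite big_ord0 sqrtr0 mul0r.
  rewrite !integral_cst//; congr (_ * _)%E.
  transitivity (1%E : \bar R); first exact: (@probability_setT _ _ _ P).
  exact/esym/(@probability_setT _ _ _ N01).
have mf : measurable_fun setT f := continuous_measurable_fun cf.
pose h (xy : R * R) := (f (xy.1 + a k * xy.2))%:E.
have mh : measurable_fun setT h.
  apply/measurable_EFinP; apply: (measurableT_comp mf).
  apply: measurable_funD; first exact: measurable_fst.
  by apply: measurable_funM => //; exact: measurable_snd.
transitivity (\int[P]_w h (lin_comb a k w, eps k w))%E.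
  by apply: eq_integral => w _; rewrite /h/= /lin_comb big_ord_recr.
rewrite ge0_integral_joint_law//; first last.
- by move=> xy; rewrite lee_fin.
- move=> A B mA mB.
  have := @lin_comb_indep a k A [:: k] (fun=> B) mA isT.
  rewrite /= leqnn big_seq1 => /(_ isT (fun=> mB)) <-; congr (P (_ `&` _)).
  apply/seteqP; split => w /=; first by move=> Bw i /=; rewrite inE => /eqP ->.
  by apply; rewrite /= inE.
rewrite (ge0_integral_eps k (g := fun y => \int[P]_w h (lin_comb a k w, y))%E); last 2 first.
- apply: (@measurable_fun_fubini_tonelli_G _ _ _ _ R P (fun wy => h (lin_comb a k wy.1, wy.2))).
    apply: (measurableT_comp mh); apply: measurable_fun_pair => /=; last exact: measurable_snd.
    by apply: measurableT_comp; [exact: measurable_lin_comb|exact: measurable_fst].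
  by move=> wy; rewrite lee_fin.
- by move=> y; apply: integral_ge0 => w _; rewrite lee_fin.
under eq_integral => y _.
  rewrite /h/= (IH (fun x => f (x + a k * y)))//; last first.
    move=> x; apply: (@continuous_comp _ _ _ (fun x => x + a k * y) f); last exact: cf.
    by apply: cvgD; [exact: cvg_id|exact: cvg_cst].
  over.
rewrite integral_normal_normal ?sqrtr_ge0//.
by rewrite sqr_sqrtr ?big_ord_recr// sumr_ge0// => i _; rewrite sqr_ge0.
Qed.

End independent_normals.

(** * The second moment of the quadratic noise *)

Section chi_square.
Context d (T : measurableType d) (R : realType) (P : probability T R).
Variable eps : nat -> {RV P >-> R}.
Hypothesis eps_iid : iid_standard_normal eps.
Local Notation N01 := (normal_prob (0 : R) 1).

(** Equal to 3, but kept symbolic: the estimates only need a finite constant. *)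
Definition normal_fourth_moment : R := fine (\int[N01]_z (z ^+ 4)%:E).

Lemma integral_sqr_eps i : (\int[P]_w (eps i w ^+ 2)%:E = 1)%E.
Proof.
rewrite (ge0_integral_eps eps_iid i (g := fun z => (z ^+ 2)%:E)).
- exact: std_normal_second_moment.
- by apply/measurable_EFinP; exact: measurable_funX.
- by move=> x; rewrite lee_fin sqr_ge0.
Qed.

Lemma integral_expr4_eps i : (\int[P]_w (eps i w ^+ 4)%:E = normal_fourth_moment%:E)%E.
Proof.
rewrite (ge0_integral_eps eps_iid i (g := fun z => (z ^+ 4)%:E)).
- rewrite fineK// ge0_fin_numE; first exact: std_normal_fourth_moment_lty.
  by apply: integral_ge0 => x _; rewrite lee_fin exprn_even_ge0.
- by apply/measurable_EFinP; exact: measurable_funX.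
- by move=> x; rewrite lee_fin exprn_even_ge0.
Qed.

Lemma integral_sqr_eps_mul i j : i != j ->
  (\int[P]_w (eps i w ^+ 2 * eps j w ^+ 2)%:E = 1)%E.
Proof.
move=> ij; have [indep _] := eps_iid.
rewrite (ge0_integral_joint_law (X := eps i) (Y := eps j)
  (h := fun z => (z.1 ^+ 2 * z.2 ^+ 2)%:E)).
- under eq_integral => v _.
    rewrite /=; under eq_integral do rewrite EFinM.
    rewrite ge0_integralZr//; last 3 first.
    + by apply/measurable_EFinP; exact: measurable_funX.
    + by move=> w _; rewrite lee_fin sqr_ge0.
    + by rewrite lee_fin sqr_ge0.
    rewrite integral_sqr_eps mul1e.
    over.
  exact: integral_sqr_eps.
- move=> A B mA mB.
  pose C l := if l == i then A else B.
  have mC l : measurable (C l) by rewrite /C; case: ifP.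
  have := indep [:: i; j] C; rewrite /= inE ij => /(_ isT mC).
  rewrite big_cons big_seq1 /C eqxx eq_sym (negbTE ij) => <-; congr (P _).
  apply/seteqP; split => w /=.
    move=> [Aw Bw] l /=; rewrite !inE => /orP[/eqP->|/eqP->]; first by rewrite eqxx.
    by rewrite eq_sym (negbTE ij).
  move=> wC; have := wC i; have := wC j.
  by rewrite /= !inE !eqxx orbT eq_sym (negbTE ij) => /(_ isT) ? /(_ isT).
- apply/measurable_EFinP; apply: measurable_funM; apply: measurable_funX.
    exact: measurable_fst.
  exact: measurable_snd.
- by move=> z; rewrite lee_fin mulr_ge0 ?sqr_ge0.
Qed.

Lemma integral_sum_sqr_eps k : (\int[P]_w (\sum_(i < k) eps i w ^+ 2)%:E = k%:R%:E)%E.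
Proof.
under eq_integral do rewrite -sumEFin.
rewrite ge0_integral_sum//.
- under eq_bigr do rewrite integral_sqr_eps.
  by rewrite sumEFin sumr_const card_ord.
- by move=> i; apply/measurable_EFinP; exact: measurable_funX.
- by move=> i x _; rewrite lee_fin sqr_ge0.
Qed.

Let measurable_sum_sqr_eps k : measurable_fun setT (fun w => \sum_(i < k) eps i w ^+ 2).
Proof. by apply: measurable_sum => i; exact: measurable_funX. Qed.

Lemma integral_sqr_sum_sqr_eps k :
  (\int[P]_w ((\sum_(i < k) eps i w ^+ 2) ^+ 2)%:E =
   (k%:R * normal_fourth_moment + k%:R * (k%:R - 1))%:E)%E.
Proof.
elim: k => [|k IH].
  under eq_integral do rewrite big_ord0 expr0n.
  by rewrite integral_cst// !mul0r addr0 mul0e.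
have mX2 i : measurable_fun setT (fun w => eps i w ^+ 2) by exact: measurable_funX.
have mX4 i : measurable_fun setT (fun w => eps i w ^+ 4) by exact: measurable_funX.
transitivity (\int[P]_w (((\sum_(i < k) eps i w ^+ 2) ^+ 2)%:E +
   ((\sum_(i < k) (2 * (eps i w ^+ 2 * eps k w ^+ 2)))%:E + (eps k w ^+ 4)%:E)))%E.
  apply: eq_integral => w _; rewrite big_ord_recr/= -mulr_sumr -mulr_suml -!EFinD.
  by congr (_%:E); ring.
rewrite ge0_integralD//; first last.
- apply: emeasurable_funD; apply/measurable_EFinP => //.
  by apply: measurable_sum => i; do 2 (apply: measurable_funM => //).
- move=> w _; rewrite adde_ge0// lee_fin ?exprn_even_ge0// sumr_ge0// => i _.
  by rewrite mulr_ge0// mulr_ge0// sqr_ge0.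
- apply/measurable_EFinP; apply: measurable_funX; exact: measurable_sum_sqr_eps.
- by move=> w _; rewrite lee_fin sqr_ge0.
rewrite ge0_integralD//; first last.
- exact/measurable_EFinP/mX4.
- by move=> w _; rewrite lee_fin exprn_even_ge0.
- by apply/measurable_EFinP; apply: measurable_sum => i; do 2 (apply: measurable_funM => //).
- by move=> w _; rewrite lee_fin sumr_ge0// => i _; rewrite mulr_ge0// mulr_ge0// sqr_ge0.
rewrite IH integral_expr4_eps.
under eq_integral do rewrite -sumEFin.
rewrite ge0_integral_sum//; first last.
- by move=> i w _; rewrite lee_fin mulr_ge0// mulr_ge0// sqr_ge0.
- by move=> i; apply/measurable_EFinP; do 2 (apply: measurable_funM => //).
rewrite (eq_bigr (fun=> 2%:E))%E; last first.
  move=> i _; under eq_integral do rewrite EFinM.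
  rewrite ge0_integralZl//.
  - by rewrite integral_sqr_eps_mul ?mule1// ltn_eqF.
  - by apply/measurable_EFinP; apply: measurable_funM.
  - by move=> w _; rewrite lee_fin mulr_ge0 ?sqr_ge0.
rewrite sumEFin sumr_const card_ord -!EFinD -natr1 -mulr_natl; congr (_%:E); ring.
Qed.

(** With [Q] the sum of squares, [(Q - k)^2 + 2 k Q = Q^2 + k^2] is an identity
    between nonnegative functions, so it can be integrated term by term without
    discussing integrability. *)
Lemma integral_sqr_centered_chi_square k :
  (\int[P]_w ((\sum_(i < k) (eps i w ^+ 2 - 1)) ^+ 2)%:E =
   (k%:R * (normal_fourth_moment - 1))%:E)%E.
Proof.
pose Q w : R := \sum_(i < k) eps i w ^+ 2.
have Q0 w : 0 <= Q w by apply: sumr_ge0 => i _; rewrite sqr_ge0.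
have mQ : measurable_fun setT Q by exact: measurable_sum_sqr_eps.
have mQ2 : measurable_fun setT (fun w => Q w ^+ 2) by exact: measurable_funX.
under eq_integral => w _ do rewrite sumrB sumr_const card_ord -/(Q w).
have : (\int[P]_w ((Q w - k%:R) ^+ 2)%:E + \int[P]_w ((2 * k%:R) * Q w)%:E =
    \int[P]_w (Q w ^+ 2)%:E + \int[P]_w (k%:R ^+ 2)%:E)%E.
  have mcst (r : R) : measurable_fun setT (fun=> r : R) := measurable_cst _.
  transitivity (\int[P]_w (((Q w - k%:R) ^+ 2)%:E + ((2 * k%:R) * Q w)%:E))%E.
    rewrite ge0_integralD//.
    - by move=> w _; rewrite lee_fin sqr_ge0.
    - by apply/measurable_EFinP; apply: measurable_funX; apply: measurable_funB.
    - by move=> w _; rewrite lee_fin mulr_ge0// mulr_ge0.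
    - by apply/measurable_EFinP; apply: measurable_funM.
  transitivity (\int[P]_w ((Q w ^+ 2)%:E + (k%:R ^+ 2)%:E))%E; last first.
    rewrite ge0_integralD//.
    - by move=> w _; rewrite lee_fin sqr_ge0.
    - exact/measurable_EFinP.
  by apply: eq_integral => w _; rewrite -!EFinD; congr (_%:E); ring.
rewrite integral_sqr_sum_sqr_eps integral_cst//= probability_setT mule1.
under [X in (_ + X)%E = _ -> _]eq_integral do rewrite EFinM.
rewrite ge0_integralZl//; last 2 first.
- exact/measurable_EFinP.
- by move=> w _; rewrite lee_fin.
rewrite integral_sum_sqr_eps -EFinM -EFinD.
case: (\int[P]_w _)%E => // r [rE]; congr (_%:E).
have -> : r = k%:R * normal_fourth_moment + k%:R * (k%:R - 1) + k%:R ^+ 2 -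
    2 * k%:R * k%:R by rewrite -rE; ring.
by ring.
Qed.

End chi_square.

(** * The class of sequences and the tail of theta *)

Section class.
Variables (R : realType) (alpha : R).
Hypothesis alpha_gt : 2^-1 < alpha.
Local Notation p := (2 * alpha - 1).

(** The tail sum is compared with the telescoping sum of [i^(-q)] instead of an
    integral: by convexity [i^(-q) - (i + 1)^(-q) >= q (i + 1)^(-q - 1)], which
    follows here from [1 + v <= exp v] and [ln (1 - 1 / x) <= - 1 / x]. *)
Lemma powRN_telescope (q : R) (i : nat) : 0 < q -> (0 < i)%N ->
  i.+1%:R `^ (- (q + 1)) <= q^-1 * (i%:R `^ (- q) - i.+1%:R `^ (- q)).
Proof.
move=> q0 i0; set x : R := i.+1%:R; set y : R := i%:R.
have x0 : 0 < x by rewrite ltr0n.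
have y0 : 0 < y by rewrite ltr0n.
have ln_le : x^-1 <= ln x - ln y.
  have : ln (1 - x^-1) <= - x^-1.
    by apply: le_ln1Dx; rewrite ltrN2 invf_lt1// /x ltr1n ltnS.
  rewrite (_ : 1 - x^-1 = y / x); last first.
    by rewrite /x /y -natr1; field; rewrite natr1 pnatr_eq0.
  by rewrite ln_div ?posrE// -lerN2 opprK opprB.
rewrite mulrC ler_pdivlMr//.
have -> : x `^ (- (q + 1)) = x `^ (- q) * x^-1.
  by rewrite opprD powRD ?(gt_eqF x0) ?implybT// powR_inv1// ltW.
have -> : y `^ (- q) = x `^ (- q) * expR (q * (ln x - ln y)).
  rewrite /powR !gt_eqF// -expRD; congr expR; ring.
have := expR_ge1Dx (q * (ln x - ln y)).
have : q * x^-1 <= q * (ln x - ln y) by rewrite ler_pM2l.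
have : 0 < x `^ (- q) by rewrite powR_gt0.
set e := expR _; set w := x `^ _; set v := q * (_ - _) => w0 h1 h2.
rewrite -[X in _ <= _ - X]mulr1 -mulrBr -mulrA ler_pM2l// mulrC.
by rewrite (le_trans h1)// lerBrDl.
Qed.

Let p_gt0 : 0 < p. Proof. by move: alpha_gt; lra. Qed.

Lemma coef_class_sqr_le (b : nat -> R) i : coef_class alpha b ->
  b i ^+ 2 <= i.+1%:R `^ (- (p + 1)).
Proof.
move=> /(_ i) bi; rewrite subrK -mulrN powRrM.
have -> : i.+1%:R `^ 2 = i.+1%:R ^+ 2 :> R by rewrite powR_mulrn.
rewrite -real_normK ?num_real//.
rewrite (_ : (i.+1%:R ^+ 2) `^ (- alpha) = (i.+1%:R `^ (- alpha)) ^+ 2); last first.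
  by rewrite -powR_mulrn// -powRrM -powR_mulrn ?powR_ge0// -powRrM mulrC.
by rewrite lerXn2r ?nnegrE ?powR_ge0.
Qed.

Lemma coef_class_sum_le (b : nat -> R) m n : coef_class alpha b -> (0 < m)%N ->
  \sum_(m <= i < n) b i ^+ 2 <= p^-1 * m%:R `^ (- p).
Proof.
move=> bC m0; have [mn|nm] := leqP m n; last first.
  by rewrite big_geq ?(ltnW nm)// mulr_ge0 ?powR_ge0// invr_ge0 ltW.
apply: (@le_trans _ _ (p^-1 * (m%:R `^ (- p) - n%:R `^ (- p)))); last first.
  by rewrite ler_pM2l ?invr_gt0// gerBl powR_ge0.
elim: n mn => [|n IH]; first by rewrite leqn0 => /eqP m00; rewrite m00 in m0.
rewrite leq_eqVlt => /predU1P[<-|]; first by rewrite big_geq// subrr mulr0.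
rewrite ltnS => mn; rewrite big_nat_recr//=.
have := powRN_telescope p_gt0 (leq_trans m0 mn).
have := coef_class_sqr_le n bC; have := IH mn.
rewrite !mulrBr; lra.
Qed.

Let series_sqr_homo (b : nat -> R) :
  {homo series (fun i => b i ^+ 2) : n k / (n <= k)%N >-> n <= k}.
Proof. by move=> n k nk; apply: nondecreasing_series => // i _ _; rewrite sqr_ge0. Qed.

Let series_sqr_bound (b : nat -> R) m n : coef_class alpha b -> (0 < m)%N -> (m <= n)%N ->
  series (fun i => b i ^+ 2) n <= series (fun i => b i ^+ 2) m + p^-1 * m%:R `^ (- p).
Proof.
move=> bC m0 mn; rewrite /series/= (big_cat_nat (n := m))//= lerD2l.
exact: coef_class_sum_le.
Qed.

Lemma cvg_theta (b : nat -> R) : coef_class alpha b ->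
  series (fun i => b i ^+ 2) @ \oo --> theta b.
Proof.
move=> bC; apply: nondecreasing_is_cvgn; first exact: series_sqr_homo.
exists (series (fun i => b i ^+ 2) 1%N + p^-1 * 1%:R `^ (- p)) => _ [n _ <-].
apply: le_trans (series_sqr_bound bC (ltnSn _) (leq_maxr n 1)).
by apply: series_sqr_homo; exact: leq_maxl.
Qed.

Lemma theta_ge_partial (b : nat -> R) n : coef_class alpha b ->
  \sum_(i < n) b i ^+ 2 <= theta b.
Proof.
move=> bC; have := nondecreasing_cvgn_le (@series_sqr_homo b) (cvg_theta bC : cvgn _) n.
by rewrite /series/= big_mkord.
Qed.

Lemma theta_ge0 (b : nat -> R) : coef_class alpha b -> 0 <= theta b.
Proof. by move=> bC; have := theta_ge_partial 0 bC; rewrite big_ord0. Qed.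

Lemma theta_tail_le (b : nat -> R) m : coef_class alpha b -> (0 < m)%N ->
  theta b - \sum_(i < m) b i ^+ 2 <= p^-1 * m%:R `^ (- p).
Proof.
move=> bC m0; rewrite lerBlDl.
apply: limr_le; first exact: cvg_theta bC.
near=> n; rewrite -(big_mkord xpredT (fun i => b i ^+ 2)); apply: series_sqr_bound => //.
by near: n; exact: nbhs_infty_ge.
Unshelve. all: by end_near.
Qed.

Lemma nneseries_sqr_theta (b : nat -> R) : coef_class alpha b ->
  (\sum_(i <oo) (b i ^+ 2)%:E = (theta b)%:E)%E.
Proof.
move=> bC; apply/cvg_lim => //.
rewrite (_ : (fun n => _) = EFin \o series (fun i => b i ^+ 2)).
  by apply: cvg_EFin => //=; [exact: nearW|exact: cvg_theta].
by apply/funext => n; rewrite /= sumEFin.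
Qed.

End class.

(** * The semiparametric information *)

Section info.
Variables (R : realType) (alpha : R).
Hypothesis alpha_gt : 2^-1 < alpha.
Variable beta : nat -> R.
Hypothesis betaC : coef_class alpha beta.

Lemma submodel_infoE n (b h : nat -> R) : (0 < n)%N ->
  submodel_info n b h = (n%:R%:E * \sum_(i <oo) (h i ^+ 2)%:E)%E.
Proof.
move=> n0; rewrite /submodel_info -nneseriesZl; last first.
  by move=> i _; rewrite lee_fin sqr_ge0.
apply: eq_eseriesr => i _.
rewrite normal_location_infoE ?invr_gt0 ?sqrtr_gt0 ?ltr0n// muleC.
by rewrite -exprVn invrK sqr_sqrtr.
Qed.

(** With [u = (y - x) / t = h + e], the increment is [2 x u + t u^2].  The cross
    term is split by [2 l x u <= l^2 x^2 + u^2] and the square of [h + e] by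
    [2 h e <= del h^2 + e^2 / del].  Being quadratic and coordinatewise, these
    bounds can be summed, which replaces the use of norms in l^2. *)
Lemma sqr_increment_le (x y h t l del : R) : 0 < t -> 0 < l -> 0 < del ->
  l * `|(y ^+ 2 - x ^+ 2) / t| <=
  l ^+ 2 * x ^+ 2 + (1 + t * l) * ((1 + del) * h ^+ 2 + (1 + del^-1) * ((y - x) / t - h) ^+ 2).
Proof.
move=> t0 l0 del0; set u := (y - x) / t.
have -> : (y ^+ 2 - x ^+ 2) / t = 2 * x * u + t * u ^+ 2.
  by rewrite /u; field; rewrite gt_eqF.
have u2 : u ^+ 2 <= (1 + del) * h ^+ 2 + (1 + del^-1) * (u - h) ^+ 2.
  rewrite -subr_ge0 (_ : _ - _ = del^-1 * (del * h - (u - h)) ^+ 2).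
    by rewrite mulr_ge0 ?sqr_ge0// invr_ge0 ltW.
  by field; rewrite gt_eqF.
apply: (@le_trans _ _ (l ^+ 2 * x ^+ 2 + (1 + t * l) * u ^+ 2)); last first.
  by rewrite lerD2l ler_pM2l// ltr_wpDr// mulr_ge0// ltW.
rewrite -{1}(gtr0_norm l0) -normrM ler_norml.
have := sqr_ge0 (l * x - u); have := sqr_ge0 (l * x + u).
have : 0 <= l * t * u ^+ 2 by rewrite mulr_ge0 ?sqr_ge0// mulr_ge0// ltW.
by move=> h1 h2 h3; apply/andP; split; nra.
Qed.

(** Cauchy-Schwarz for the derivative [D = 2 <beta, h>] of theta, in the form
    with a free parameter [l] that comes out of summing [sqr_increment_le] and
    letting first [t] and then [del] tend to 0. *)
Lemma regular_submodel_dtheta_le (b : R -> nat -> R) (h : nat -> R) (D l H : R) :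
  regular_submodel alpha beta b h ->
  ((theta (b t) - theta beta) / t) @[t --> (0 : R)^'+] --> D ->
  (\sum_(i <oo) (h i ^+ 2)%:E = H%:E)%E -> 0 < l ->
  l * `|D| <= l ^+ 2 * theta beta + H.
Proof.
move=> [b0 bC _ berr] bD hH l0.
have H0 : 0 <= H.
  by rewrite -lee_fin -hH; apply: nneseries_ge0 => i _ _; rewrite lee_fin sqr_ge0.
pose err t := (\sum_(i <oo) (((b t i - beta i) / t - h i) ^+ 2)%:E)%E.
have /fine_cvgP[err_fin err_cvg] : err t @[t --> 0^'+] --> 0%:E by [].
have bnd del : 0 < del -> l * `|D| <= l ^+ 2 * theta beta + (1 + del) * H.
  move=> del0.
  pose rhs t := l ^+ 2 * theta beta + (1 + t * l) * ((1 + del) * H + (1 + del^-1) * fine (err t)).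
  have rhs_cvg : rhs t @[t --> 0^'+] -->
      l ^+ 2 * theta beta + (1 + 0 * l) * ((1 + del) * H + (1 + del^-1) * 0).
    have idc : t @[t --> (0:R)^'+] --> (0 : R) by apply: cvg_at_right_filter; exact: cvg_id.
    apply: cvgD; first exact: cvg_cst.
    apply: cvgM.
      by apply: cvgD; [exact: cvg_cst|apply: cvgM; [exact: idc|exact: cvg_cst]].
    apply: cvgD; first exact: cvg_cst.
    by apply: cvgM; [exact: cvg_cst|exact: err_cvg].
  have lhs_cvg : l * `|(theta (b t) - theta beta) / t| @[t --> 0^'+] --> l * `|D|.
    by apply: cvgM; [exact: cvg_cst|exact: cvg_norm].
  move: rhs_cvg; rewrite mul0r addr0 mul1r mulr0 addr0 => rhs_cvg.
  apply: (ler_cvg_to lhs_cvg rhs_cvg).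
  near=> t.
  have t0 : 0 < t by near: t; exact: nbhs_right_gt.
  have btC : coef_class alpha (b t) by near: t; exact: bC.
  have errt : err t \is a fin_num by near: t; exact: err_fin.
  have scvg : (fun n => l * `|(series (fun i => b t i ^+ 2) n -
      series (fun i => beta i ^+ 2) n) / t|) @ \oo -->
     l * `|(theta (b t) - theta beta) / t|.
    apply: cvgM; first exact: cvg_cst.
    apply: cvg_norm; apply: cvgM; last exact: cvg_cst.
    by apply: cvgB; exact: (cvg_theta alpha_gt).
  apply: (ler_cvg_to scvg (cvg_cst (rhs t))).
  apply: nearW => n.
  rewrite /series/= -sumrB mulr_suml.
  apply: (@le_trans _ _ (\sum_(0 <= i < n) (l * `|(b t i ^+ 2 - beta i ^+ 2) / t|))).
    by rewrite -mulr_sumr ler_pM2l// ler_norm_sum.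
  apply: (@le_trans _ _ (\sum_(0 <= i < n) (l ^+ 2 * beta i ^+ 2 + (1 + t * l) *
      ((1 + del) * h i ^+ 2 + (1 + del^-1) * ((b t i - beta i) / t - h i) ^+ 2)))).
    by apply: ler_sum => i _; exact: sqr_increment_le.
  rewrite big_split/= -!mulr_sumr big_split/= -!mulr_sumr /rhs.
  apply: lerD.
    rewrite ler_pM2l ?exprn_gt0// big_mkord; exact: (theta_ge_partial alpha_gt).
  rewrite ler_pM2l; last by rewrite ltr_wpDr// mulr_ge0// ltW.
  apply: lerD.
    rewrite ler_pM2l; last by rewrite ltr_wpDr// ltW.
    rewrite -lee_fin -hH -sumEFin; apply: nneseries_lim_ge => i _ _.
    by rewrite lee_fin sqr_ge0.
  rewrite ler_pM2l; last by rewrite ltr_wpDr// invr_ge0 ltW.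
  rewrite -lee_fin fineK// -sumEFin; apply: nneseries_lim_ge => i _ _.
  by rewrite lee_fin sqr_ge0.
apply/ler_addgt0Pr => e e0.
have H1 : 0 < H + 1 by rewrite ltr_wpDl.
apply: le_trans (bnd (e / (H + 1)) _) _; first by rewrite divr_gt0.
by rewrite -addrA lerD2l mulrDl mul1r lerD2l mulrAC ler_pdivrMr// ler_pM2l// lerDl.
Unshelve. all: by end_near.
Qed.

(** The choice [l = |D| / (2 theta)] is optimal; when theta is 0, any
    [l > H / |D|] contradicts the bound unless [D = 0]. *)
Let dtheta_le (b : R -> nat -> R) (h : nat -> R) (D H : R) :
  regular_submodel alpha beta b h ->
  ((theta (b t) - theta beta) / t) @[t --> (0 : R)^'+] --> D ->
  (\sum_(i <oo) (h i ^+ 2)%:E = H%:E)%E ->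
  D ^+ 2 <= 4 * theta beta * H.
Proof.
move=> reg bD hH.
have bnd l : 0 < l -> l * `|D| <= l ^+ 2 * theta beta + H.
  by move=> l0; exact: regular_submodel_dtheta_le reg bD hH l0.
have th0 := theta_ge0 alpha_gt betaC.
rewrite -real_normK ?num_real//.
have [->|D0] := eqVneq D 0.
  rewrite normr0 expr0n.
  rewrite !mulr_ge0// -lee_fin -hH; apply: nneseries_ge0 => i _ _.
  by rewrite lee_fin sqr_ge0.
have nD0 : 0 < `|D| by rewrite normr_gt0.
move: th0; rewrite le_eqVlt => /predU1P[th0|th0].
  have H0 : 0 <= H.
    by rewrite -lee_fin -hH; apply: nneseries_ge0 => i _ _; rewrite lee_fin sqr_ge0.
  have := bnd ((H + 1) / `|D|).
  rewrite -th0 mulr0 add0r divfK ?gt_eqF// divr_gt0 ?ltr_wpDl// => /(_ isT); lra.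
have := bnd (`|D| / (2 * theta beta)).
rewrite divr_gt0 ?mulr_gt0// => /(_ isT).
rewrite [X in X <= _](_ : _ = 2 * (`|D| ^+ 2 / (4 * theta beta))); last by field; rewrite gt_eqF.
rewrite [X in _ <= X + _](_ : _ = `|D| ^+ 2 / (4 * theta beta)); last by field; rewrite gt_eqF.
move=> DH; have : `|D| ^+ 2 / (4 * theta beta) <= H by lra.
by rewrite ler_pdivrMr ?mulr_gt0// mulrC.
Qed.

Let shrink_regular : regular_submodel alpha beta (fun t i => (1 - t) * beta i) (fun i => - beta i).
Proof.
split.
- by apply/funext => i; rewrite subr0 mul1r.
- near=> t => i.
  rewrite normrM (le_trans _ (betaC i))// ler_piMl// ler_norml.
  have t0 : 0 < t by near: t; exact: nbhs_right_gt.
  have t1 : t < 1 by near: t; exact: nbhs_right_lt.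
  by apply/andP; split; lra.
- under eq_eseriesr do rewrite sqrrN.
  by rewrite (nneseries_sqr_theta alpha_gt betaC) ltry.
- apply: cvg_near_cst; near=> t.
  have t0 : 0 < t by near: t; exact: nbhs_right_gt.
  rewrite eseries0// => i _ _; rewrite (_ : _ - _ = 0) ?expr0n//.
  by field; rewrite gt_eqF.
Unshelve. all: by end_near.
Qed.

Let shrink_theta t :
  theta (fun i => (1 - t) * beta i) = (1 - t) ^+ 2 * theta beta.
Proof.
apply/cvg_lim => //.
rewrite (_ : series _ = fun n => (1 - t) ^+ 2 * series (fun i => beta i ^+ 2) n).
  by apply: cvgM; [exact: cvg_cst|exact: (cvg_theta alpha_gt)].
apply/funext => n; rewrite /series/= mulr_sumr; apply: eq_bigr => i _.
by rewrite exprMn.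
Qed.

Let shrink_dtheta :
  ((theta (fun i => (1 - t) * beta i) - theta beta) / t) @[t --> (0 : R)^'+] -->
  - (2 * theta beta).
Proof.
have : (t - 2) * theta beta @[t --> (0:R)^'+] --> (0 - 2) * theta beta.
  apply: cvgM; last exact: cvg_cst.
  by apply: cvgB; [apply: cvg_at_right_filter; exact: cvg_id|exact: cvg_cst].
rewrite sub0r mulNr; apply: cvg_trans; apply: near_eq_cvg; near=> t.
have t0 : 0 < t by near: t; exact: nbhs_right_gt.
by rewrite shrink_theta; field; rewrite gt_eqF.
Unshelve. all: by end_near.
Qed.

Lemma inv_semiparametric_info n : (0 < n)%N ->
  ((semiparametric_info alpha beta n)^-1)%E = (4 * theta beta / n%:R)%:E.
Proof.
move=> n0; have th0 := theta_ge0 alpha_gt betaC.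
have nR0 : 0 < n%:R :> R by rewrite ltr0n.
have h_fin (h : nat -> R) : (\sum_(i <oo) (h i ^+ 2)%:E < +oo)%E ->
    exists H, (\sum_(i <oo) (h i ^+ 2)%:E = H%:E)%E.
  move=> hoo; exists (fine (\sum_(i <oo) (h i ^+ 2)%:E)%E).
  rewrite fineK// ge0_fin_numE//; apply: nneseries_ge0 => i _ _.
  by rewrite lee_fin sqr_ge0.
have [th_eq0|th_neq0] := eqVneq (theta beta) 0.
  rewrite th_eq0 mulr0 mul0r /semiparametric_info (_ : [set x | _] = set0) ?ereal_inf0//.
  apply/seteqP; split => // x [b [h [D [reg bD D0 _]]]].
  have [_ _ /h_fin[H hH] _] := reg.
  have := dtheta_le reg bD hH; rewrite th_eq0 mulr0 mul0r => D2.
  by have := le_anti (introT andP (conj D2 (sqr_ge0 D))) => /eqP; rewrite sqrf_eq0 (negbTE D0).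
have {th_neq0}th_gt0 : 0 < theta beta by rewrite lt_neqAle eq_sym th_neq0.
rewrite (_ : semiparametric_info _ _ _ = (n%:R / (4 * theta beta))%:E).
  by rewrite inver mulf_eq0 invr_eq0 !gt_eqF ?mulr_gt0//= invf_div.
apply/le_anti/andP; split.
- apply: ereal_inf_lbound.
  exists (fun t i => (1 - t) * beta i), (fun i => - beta i), (- (2 * theta beta)).
  split; [exact: shrink_regular|exact: shrink_dtheta|by rewrite oppr_eq0 gt_eqF ?mulr_gt0|].
  rewrite submodel_infoE//; under eq_eseriesr do rewrite sqrrN.
  rewrite (nneseries_sqr_theta alpha_gt betaC) -!EFinM; congr (_%:E).
  by field; rewrite gt_eqF.
- apply/ereal_infP => _ [b [h [D [reg bD D0 ->]]]].
  have [_ _ /h_fin[H hH] _] := reg.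
  rewrite submodel_infoE// hH -!EFinM lee_fin.
  have D20 : 0 < D ^+ 2 by rewrite exprn_even_gt0//= D0.
  rewrite ler_pdivlMr// mulrAC ler_pdivrMr ?mulr_gt0// -mulrA ler_pM2l// mulrC.
  by exact: dtheta_le reg bD hH.
Qed.

End info.

(** * Perturbations that vanish in mean square *)

Section slutsky.
Variable R : realType.
Local Notation N01 := (normal_prob (0 : R) 1).

(** A test function is uniformly continuous on compact sets only.  When [x]
    leaves [[- K, K]] or [r] is not small, one of the two quotients is at least 1
    and the trivial bound [2 M] applies.  Having the bound for all [x] and [r]
    reduces the comparison of expectations to second moments. *)
Lemma perturbation_le (f : R -> R) (M e K : R) : continuous f ->
  (forall x, `|f x| <= M) -> 0 < e -> 0 < K ->
  exists2 del, 0 < del & forall x r,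
    `|f (x + r) - f x| <= e + 2 * M * (x ^+ 2 / K ^+ 2 + r ^+ 2 / del ^+ 2).
Proof.
move=> cf fM e0 K0.
have M0 : 0 <= M by apply: le_trans (fM 0).
have near_small : \forall r \near (0 : R), `[(- K), K] `<=` [set x | `|f (x + r) - f x| <= e].
  have /compact_near_coveringP := @segment_compact R (- K) K.
  (* Compactness makes the radius given by continuity at (x, 0) uniform in x. *)
  move=> /(_ _ (nbhs (0 : R)) (fun r x => `|f (x + r) - f x| <= e)); apply=> x _.
  have cg : (fun z : R * R => f (z.1 + z.2) - f z.1) z @[z --> (x, 0 : R)] --> f (x + 0) - f x.
    apply: cvgB; last by apply: (cvg_comp fst f); [exact: cvg_fst|exact: cf].
    apply: (cvg_comp (fun z : R * R => z.1 + z.2) f); last exact: cf.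
    by apply: cvgD; [exact: cvg_fst|exact: cvg_snd].
  move: cg; rewrite addr0 subrr => /cvgr0Pnorm_le /(_ e e0); exact.
move: near_small => /nbhs_ballP[del /= del0 Hdel].
exists (del / 2); first by rewrite divr_gt0.
move=> x r.
have f2M : `|f (x + r) - f x| <= 2 * M.
  by rewrite (le_trans (ler_normB _ _))// mulr_natl mulr2n lerD.
have x0 : 0 <= x ^+ 2 / K ^+ 2 by rewrite divr_ge0 ?sqr_ge0.
have r0 : 0 <= r ^+ 2 / (del / 2) ^+ 2 by rewrite divr_ge0 ?sqr_ge0.
have [xK|Kx] := leP `|x| K; last first.
  apply: le_trans f2M _.
  have : 1 <= x ^+ 2 / K ^+ 2.
    by rewrite ler_pdivlMr ?exprn_gt0// mul1r -(real_normK (num_real x)) lerXn2r ?nnegrE// ltW.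
  set X := x ^+ 2 / _ in x0 *; set Y := r ^+ 2 / _ in r0 *; nra.
have [rd|dr] := ltP `|r| del; last first.
  apply: le_trans f2M _.
  have : 1 <= r ^+ 2 / (del / 2) ^+ 2.
    rewrite ler_pdivlMr ?exprn_gt0 ?divr_gt0// mul1r -(real_normK (num_real r)) lerXn2r ?nnegrE//.
      by rewrite ltW ?divr_gt0.
    by rewrite (le_trans _ dr)// ler_pdivrMr// ler_pMr// ler1n.
  set X := x ^+ 2 / _ in x0 *; set Y := r ^+ 2 / _ in r0 *; nra.
apply: (@le_trans _ _ e); last by rewrite lerDl mulr_ge0 ?addr_ge0// mulr_ge0.
apply: Hdel; first by rewrite /ball/= sub0r normrN.
by rewrite /= in_itv/= -ler_norml.
Qed.

(** Integrating [perturbation_le], the expectations of [f] differ by at most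
    [e + 2 M (B / K^2 + v n / del^2)]; [K] is chosen from [e], then [del] from
    both, then [n]. *)
Lemma cvg_to_centered_normal_perturb (d : nat -> measure_display)
    (T : forall n, measurableType (d n)) (P : forall n, probability (T n) R)
    (Z G r : forall n, T n -> R) (B V : R) (v : nat -> R) :
  (forall n, measurable_fun setT (G n)) -> (forall n, measurable_fun setT (r n)) ->
  (\forall n \near \oo, forall w, Z n w = G n w + r n w) ->
  (forall n, (\int[P n]_w (G n w ^+ 2)%:E <= B%:E)%E) ->
  (\forall n \near \oo, (\int[P n]_w (r n w ^+ 2)%:E <= (v n)%:E)%E) ->
  v @ \oo --> (0 : R) ->
  cvg_to_centered_normal P G V -> cvg_to_centered_normal P Z V.
Proof.
move=> mG mr ZGr GB rv v0 cvgG f cf [M fM].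
have M0 : 0 <= M by apply: le_trans (fM 0).
have cvgGf := cvgG f cf (ex_intro _ M fM).
have mf : measurable_fun setT f := continuous_measurable_fun cf.
have B0 : 0 <= B.
  rewrite -lee_fin; apply: le_trans (GB 0%N); apply: integral_ge0 => w _.
  by rewrite lee_fin sqr_ge0.
have int_f n (X : T n -> R) : measurable_fun setT X ->
    (P n).-integrable setT (EFin \o (f \o X)).
  move=> mX; apply: measurable_bounded_integrable => //.
  - by rewrite -ge0_fin_numE// fin_num_measure.
  - exact: measurableT_comp.
  - exists M; split; first exact: num_real.
    by move=> x Mx y _; rewrite /= (le_trans (fM _))// ltW.
have mGr n : measurable_fun setT (fun w => G n w + r n w) by exact: measurable_funD.
pose I n := \int[P n]_w f (G n w + r n w).
pose J n := \int[P n]_w f (G n w).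
have IE n : (\int[P n]_w (f (G n w + r n w))%:E = (I n)%:E)%E.
  by rewrite /I /Rintegral fineK//; apply: integrable_fin_num => //; exact: (int_f n _ (mGr n)).
have JE n : (\int[P n]_w (f (G n w))%:E = (J n)%:E)%E.
  by rewrite /J /Rintegral fineK//; apply: integrable_fin_num => //; exact: (int_f n _ (mG n)).
have IJ e K : 0 < e -> 0 < K -> exists2 del, 0 < del &
    \forall n \near \oo, `|I n - J n| <= e + 2 * M * (B / K ^+ 2 + v n / del ^+ 2).
  move=> e0 K0; have [del del0 fdel] := perturbation_le cf fM e0 K0.
  exists del => //; near=> n.
  have rvn : (\int[P n]_w (r n w ^+ 2)%:E <= (v n)%:E)%E by near: n.
  rewrite -lee_fin -abse_EFin EFinB -IE -JE.
  rewrite -integralB_EFin//; last 2 first.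
  - exact: (int_f n _ (mGr n)).
  - exact: (int_f n _ (mG n)).
  have mGd : measurable_fun setT (fun w => f (G n w + r n w) - f (G n w)).
    by apply: measurable_funB; apply: measurableT_comp.
  apply: (le_trans (le_abse_integral _ _ _)) => //; first exact/measurable_EFinP.
  have mG2 : measurable_fun setT (fun w => (G n w ^+ 2)%:E).
    by apply/measurable_EFinP; exact: measurable_funX.
  have mr2 : measurable_fun setT (fun w => (r n w ^+ 2)%:E).
    by apply/measurable_EFinP; exact: measurable_funX.
  have cK : 0 <= 2 * M / K ^+ 2 by rewrite divr_ge0 ?sqr_ge0// mulr_ge0.
  have cdel : 0 <= 2 * M / del ^+ 2 by rewrite divr_ge0 ?sqr_ge0// mulr_ge0.
  have G20 w : (0 <= (2 * M / K ^+ 2)%:E * (G n w ^+ 2)%:E)%E.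
    by rewrite mule_ge0// lee_fin sqr_ge0.
  have r20 w : (0 <= (2 * M / del ^+ 2)%:E * (r n w ^+ 2)%:E)%E.
    by rewrite mule_ge0// lee_fin sqr_ge0.
  apply: (@le_trans _ _ (\int[P n]_w (e%:E + ((2 * M / K ^+ 2)%:E * (G n w ^+ 2)%:E +
    (2 * M / del ^+ 2)%:E * (r n w ^+ 2)%:E)))%E).
    apply: ge0_le_integral => //.
    - by apply/measurable_EFinP; exact: measurableT_comp.
    - by apply: emeasurable_funD => //; apply: emeasurable_funD; apply: emeasurable_funM.
    - move=> w _; rewrite -!EFinM -!EFinD lee_fin (le_trans (fdel _ _))//.
      by rewrite lerD2l le_eqVlt; apply/orP; left; apply/eqP; ring.
  rewrite ge0_integralD//; last 3 first.
  - by move=> w _; rewrite lee_fin ltW.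
  - by move=> w _; rewrite adde_ge0.
  - by apply: emeasurable_funD; apply: emeasurable_funM.
  rewrite ge0_integralD//; last 2 first.
  - exact: emeasurable_funM.
  - exact: emeasurable_funM.
  rewrite !ge0_integralZl//; last 2 first.
  - by move=> w _; rewrite lee_fin sqr_ge0.
  - by move=> w _; rewrite lee_fin sqr_ge0.
  rewrite integral_cst//= probability_setT mule1.
  apply: (@le_trans _ _ (e%:E + ((2 * M / K ^+ 2)%:E * B%:E + (2 * M / del ^+ 2)%:E * (v n)%:E))%E).
    by rewrite leeD2l// leeD// lee_wpmul2l.
  by rewrite -!EFinM -!EFinD lee_fin le_eqVlt; apply/orP; left; apply/eqP; ring.
have diff0 : (fun n => I n - J n) @ \oo --> (0 : R).
  apply/cvgr0Pnorm_le => e e0.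
  (* As K >= 1, K^2 >= K makes 2 M B / K^2 at most e / 3; the bound on v n below
     does the same for the last term, with + 6 to cover M = 0. *)
  pose K := 1 + 6 * M * B / e.
  have MB0 : 0 <= 6 * M * B / e by rewrite divr_ge0 ?(ltW e0)// mulr_ge0// mulr_ge0.
  have K0 : 0 < K by rewrite ltr_pwDl.
  have e30 : 0 < e / 3 by rewrite divr_gt0.
  have [del del0 IJdel] := IJ _ K e30 K0.
  have ve : \forall n \near \oo, v n <= e * del ^+ 2 / (6 * M + 6).
    have /cvgr0Pnorm_le/(_ (e * del ^+ 2 / (6 * M + 6))) := v0.
    rewrite divr_gt0 ?mulr_gt0 ?exprn_gt0//; last by rewrite ltr_wpDl// mulr_ge0.
    move=> /(_ isT); apply: filterS => n; exact: le_trans (ler_norm _).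
  near=> n.
  have IJn : `|I n - J n| <= e / 3 + 2 * M * (B / K ^+ 2 + v n / del ^+ 2) by near: n.
  apply: le_trans IJn _.
  have vn : v n <= e * del ^+ 2 / (6 * M + 6) by near: n.
  have h1 : 2 * M * (B / K ^+ 2) <= e / 3.
    rewrite mulrA ler_pdivrMr ?exprn_gt0//.
    have KK : 6 * M * B / e <= K ^+ 2.
      by rewrite expr2 (@le_trans _ _ K) ?ler_peMr// /K ?lerDr ?lerDl// ltW.
    move: KK; rewrite ler_pdivrMr//; lra.
  have h2 : 2 * M * (v n / del ^+ 2) <= e / 3.
    have vn2 : v n / del ^+ 2 <= e / (6 * M + 6).
      by rewrite ler_pdivrMr ?exprn_gt0// mulrAC.
    apply: le_trans (ler_wpM2l _ vn2) _; first by rewrite mulr_ge0.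
    rewrite mulrA ler_pdivrMr; last by rewrite ltr_wpDl// mulr_ge0.
    by have := mulr_ge0 M0 (ltW e0); lra.
  rewrite mulrDr; lra.
have [l lE] : exists l : R, (\int[N01]_z (f (Num.sqrt V * z))%:E = l%:E)%E.
  exists (fine (\int[N01]_z (f (Num.sqrt V * z))%:E)); rewrite fineK//.
  apply: integrable_fin_num => //; apply: measurable_bounded_integrable => //.
  - by rewrite -ge0_fin_numE// fin_num_measure.
  - by apply: (measurableT_comp mf); exact: measurable_funM.
  - exists M; split; first exact: num_real.
    by move=> x Mx y _; rewrite /= (le_trans (fM _))// ltW.
rewrite lE; rewrite lE in cvgGf.
have Jl : J @ \oo --> l.
  move: cvgGf => /fine_cvgP[_]; apply: cvg_trans; apply: near_eq_cvg.
  by apply: nearW => n; rewrite /= JE.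
have Il : I @ \oo --> l.
  rewrite -[l]addr0 (_ : I = fun n => J n + (I n - J n)); last first.
    by apply/funext => n; rewrite addrC subrK.
  exact: cvgD Jl diff0.
apply: (@cvg_trans _ ((fun n => (I n)%:E) @ \oo)).
  apply: near_eq_cvg; apply: filterS ZGr => n ZGrn.
  by rewrite -IE; apply: eq_integral => w _; rewrite ZGrn.
by apply/fine_cvgP; split => //; exact: nearW.
Unshelve. all: by end_near.
Qed.
End slutsky.

(** * The Gaussian term *)

Section gaussian_part.
Variable R : realType.
Local Notation N01 := (normal_prob (0 : R) 1).

Lemma cvg_integral_normal_scale (f : R -> R) (M s : R) (s_ : nat -> R) :
  continuous f -> (forall x, `|f x| <= M) -> s_ @ \oo --> s ->
  (\int[N01]_z (f (s_ n * z))%:E)%E @[n --> \oo] --> (\int[N01]_z (f (s * z))%:E)%E.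
Proof.
move=> cf fM ss.
have mf : measurable_fun setT f := continuous_measurable_fun cf.
have mfs (c : R) : measurable_fun setT (fun z => f (c * z)).
  by apply: (measurableT_comp mf); exact: measurable_funM.
apply: (@dominated_cvg _ _ R N01 setT measurableT (fun n z => (f (s_ n * z))%:E)
  (fun z => (f (s * z))%:E) (fun=> M%:E)) => //.
- by move=> n; apply/measurable_EFinP; exact: mfs.
- move=> x _; apply: cvg_EFin; first exact: nearW.
  apply: (cvg_comp (fun n => s_ n * x) f); last exact: cf.
  by apply: cvgM; [exact: ss|exact: cvg_cst].
- exact: finite_measure_integrable_cst.
- by move=> n x _; rewrite /= lee_fin.
Qed.

(** Adding the bound [M] to [f] reduces to the nonnegative case. *)
Lemma integral_lin_comb_bounded d (T : measurableType d) (P : probability T R)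
    (eps : nat -> {RV P >-> R}) (a : nat -> R) k (f : R -> R) (M : R) :
  iid_standard_normal eps -> continuous f -> (forall x, `|f x| <= M) ->
  (\int[P]_w (f (lin_comb eps a k w))%:E =
   \int[N01]_z (f (Num.sqrt (\sum_(i < k) a i ^+ 2) * z))%:E)%E.
Proof.
move=> iid cf fM.
have mf : measurable_fun setT f := continuous_measurable_fun cf.
pose g x := f x + M.
have cg : continuous g by move=> x; apply: cvgD; [exact: cf|exact: cvg_cst].
have g0 x : 0 <= g x by have := fM x; rewrite ler_norml /g => /andP[]; lra.
have int_f d' (S : measurableType d') (Q : probability S R) (X : S -> R) :
    measurable_fun setT X ->
    (\int[Q]_w (f (X w))%:E = \int[Q]_w (g (X w))%:E - M%:E)%E.
  move=> mX.
  have intb (h : S -> R) C : measurable_fun setT h -> (forall x, `|h x| <= C) ->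
      Q.-integrable setT (EFin \o h).
    move=> mh hC; apply: measurable_bounded_integrable => //.
    - by rewrite -ge0_fin_numE// fin_num_measure.
    - exists C; split; first exact: num_real.
      by move=> x Cx y _; rewrite /= (le_trans (hC _))// ltW.
  have mfX : measurable_fun setT (f \o X) by exact: measurableT_comp.
  have -> : (\int[Q]_w (g (X w))%:E = \int[Q]_w ((f (X w))%:E + M%:E))%E by [].
  rewrite integralD_EFin//; last 2 first.
  - by apply: (intb _ M mfX) => x; exact: fM.
  - exact: finite_measure_integrable_cst.
  by rewrite integral_cst//= probability_setT mule1 addeK.
rewrite int_f; last exact: measurable_lin_comb.
rewrite [RHS]int_f; last exact: measurable_funM.
by rewrite (integral_lin_comb iid).
Qed.

Lemma integral_sqr_lin_comb d (T : measurableType d) (P : probability T R)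
    (eps : nat -> {RV P >-> R}) (a : nat -> R) k :
  iid_standard_normal eps ->
  (\int[P]_w (lin_comb eps a k w ^+ 2)%:E = (\sum_(i < k) a i ^+ 2)%:E)%E.
Proof.
move=> iid; rewrite (integral_lin_comb iid a k (f := fun x => x ^+ 2)); last 2 first.
- by move=> x; exact: exprn_continuous.
- by move=> x; exact: sqr_ge0.
under eq_integral do rewrite exprMn EFinM.
rewrite ge0_integralZl//.
- rewrite std_normal_second_moment mule1 sqr_sqrtr//.
  by apply: sumr_ge0 => i _; exact: sqr_ge0.
- by apply/measurable_EFinP; exact: measurable_funX.
- by move=> x _; rewrite lee_fin sqr_ge0.
Qed.
End gaussian_part.

(** * The bias *)

Section bias.
Variables (R : realType) (alpha : R).
Hypothesis alpha_gt : 2^-1 < alpha.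
Variable beta : nat -> R.
Hypothesis betaC : coef_class alpha beta.
Variable m : nat -> nat.
Hypothesis m_gt : (m n)%:R / n%:R `^ (4 * alpha - 2)^-1 @[n --> \oo] --> (+oo : set_system R).
Local Notation p := (2 * alpha - 1).

(** With [x = m / n^(1 / (4 alpha - 2))] and [p = 2 alpha - 1], the tail bound
    [m^(- p) / p] times [sqrt n] equals [x^(- p) / p] since
    [p / (4 alpha - 2) = 1 / 2], and [x] tends to infinity. *)
Lemma cvg_bias :
  Num.sqrt n%:R * (theta beta - \sum_(i < m n) beta i ^+ 2) @[n --> \oo] --> (0 : R).
Proof.
have p0 : 0 < p by move: alpha_gt; lra.
have q0 : 0 < 4 * alpha - 2 by lra.
apply/cvgr0Pnorm_le => e e0.
have pe0 : 0 < p * e by rewrite mulr_gt0.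
(* x^(- p) / p <= e as soon as x >= A; the 1 added below keeps x positive. *)
pose A := (p * e)^-1 `^ p^-1.
near=> n.
have n0 : (0 < n)%N by near: n; exact: nbhs_infty_gt.
have xA : A + 1 <= (m n)%:R / n%:R `^ (4 * alpha - 2)^-1.
  by near: n; move/cvgryPge : m_gt; apply.
set x := (m n)%:R / _ in xA.
have nR0 : 0 < n%:R :> R by rewrite ltr0n.
have y0 : 0 < n%:R `^ (4 * alpha - 2)^-1 by rewrite powR_gt0.
have A0 : 0 <= A := powR_ge0 _ _.
have x0 : 0 < x by rewrite (lt_le_trans _ xA)// ltr_wpDl.
have m0 : (0 < m n)%N.
  by rewrite lt0n; apply/eqP => m0; move: x0; rewrite /x m0 mul0r ltxx.
rewrite ger0_norm; last by rewrite mulr_ge0 ?sqrtr_ge0// subr_ge0 (theta_ge_partial alpha_gt).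
apply: (@le_trans _ _ (Num.sqrt n%:R * (p^-1 * (m n)%:R `^ (- p)))).
  by rewrite ler_pM2l ?sqrtr_gt0//; exact: theta_tail_le.
have mE : (m n)%:R = x * n%:R `^ (4 * alpha - 2)^-1 by rewrite /x divfK// gt_eqF.
rewrite mE powRM ?(ltW x0)// ?(ltW y0)// -powRrM.
have -> : (4 * alpha - 2)^-1 * - p = - 2^-1 by field; rewrite gt_eqF.
rewrite (powRN n%:R) powR12_sqrt//.
have s0 : Num.sqrt n%:R != 0 :> R by rewrite gt_eqF// sqrtr_gt0.
rewrite mulrC -!mulrA mulVf// mulr1.
rewrite mulrC ler_pdivrMr// powRN.
have xp : (p * e)^-1 <= x `^ p.
  have -> : (p * e)^-1 = A `^ p by rewrite /A -powRrM mulVf ?gt_eqF// powRr1// invr_ge0 ltW.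
  apply: ge0_ler_powR; rewrite ?nnegrE ?(ltW p0)// ?(ltW x0)//.
  by apply: le_trans xA; rewrite lerDl.
rewrite -[leRHS]invrK lef_pV2 ?posrE ?(powR_gt0 _ x0) ?invr_gt0 ?(mulr_gt0 e0 p0)//.
by rewrite [e * _]mulrC.
Unshelve. all: by end_near.
Qed.

(** The partial sums converge because even [sqrt n] times the remainder does. *)
Lemma cvg_partial_sum : \sum_(i < m n) beta i ^+ 2 @[n --> \oo] --> theta beta.
Proof.
have : theta beta - \sum_(i < m n) beta i ^+ 2 @[n --> \oo] --> (0 : R).
  apply: (squeeze_cvgr _ (cvg_cst 0) cvg_bias).
  near=> n; have n0 : (0 < n)%N by near: n; exact: nbhs_infty_gt.
  have h : 0 <= theta beta - \sum_(i < m n) beta i ^+ 2.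
    by rewrite subr_ge0 (theta_ge_partial alpha_gt).
  by rewrite h/= ler_peMl// -[leLHS]sqrtr1 ler_wsqrtr// ler1n.
move=> /(cvgB (cvg_cst (theta beta))); rewrite subr0.
apply: cvg_trans; apply: near_eq_cvg; apply: nearW => n /=.
by rewrite opprB addrC subrK.
Unshelve. all: by end_near.
Qed.

End bias.

(** * Asymptotic efficiency *)

Section decomposition.
Variable R : realType.

Lemma theta_hat_decomposition (T : Type) (n k : nat) (b : nat -> R)
    (e : nat -> T -> R) (th : R) (w : T) : (0 < n)%N ->
  Num.sqrt n%:R * (theta_hat n k (observation n b e) w - th) =
  \sum_(i < k) 2 * b i * e i w +
  ((Num.sqrt n%:R)^-1 * \sum_(i < k) (e i w ^+ 2 - 1) -
   Num.sqrt n%:R * (th - \sum_(i < k) b i ^+ 2)).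
Proof.
move=> n0; set s := Num.sqrt n%:R.
have s0 : s != 0 by rewrite gt_eqF// sqrtr_gt0 ltr0n.
have ns : n%:R = s ^+ 2 by rewrite sqr_sqrtr.
have -> : theta_hat n k (observation n b e) w =
    \sum_(i < k) b i ^+ 2 + s^-1 * \sum_(i < k) 2 * b i * e i w +
    s^-1 ^+ 2 * \sum_(i < k) (e i w ^+ 2 - 1).
  rewrite /theta_hat !mulr_sumr -!big_split/=; apply: eq_bigr => i _.
  by rewrite /observation -/s ns; field.
by field.
Qed.

End decomposition.

Theorem proposition5p1 (R : realType) (alpha : R)
    (halpha : 3%:R / 4%:R < alpha < 1)
    (beta : nat -> R) (hbeta : coef_class alpha beta)
    (d : nat -> measure_display) (T : forall n : nat, measurableType (d n))
    (P : forall n : nat, probability (T n) R)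
    (eps : forall n : nat, nat -> {RV (P n) >-> R})
    (heps : forall n : nat, iid_standard_normal (eps n))
    (m : nat -> nat) (hm : cutoff_range alpha m) :
  efficient alpha beta P
    (fun n : nat => theta_hat n (m n) (observation n beta (fun i => eps n i))).
Proof.
have a12 : 2^-1 < alpha.
  by case/andP: halpha; rewrite ltr_pdivrMr ?ltr0n// => h _; lra.
have [hm1 hm2] := hm.
have th0 := theta_ge0 a12 hbeta.
pose c4 := normal_fourth_moment R.
pose bias n := Num.sqrt n%:R * (theta beta - \sum_(i < m n) beta i ^+ 2).
have bias0 : bias @ \oo --> (0 : R) := cvg_bias a12 hbeta hm1.
have sumE n : \sum_(i < m n) (2 * beta i) ^+ 2 = 4 * \sum_(i < m n) beta i ^+ 2.
  by rewrite mulr_sumr; apply: eq_bigr => i _; ring.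
pose G n : T n -> R := lin_comb (eps n) (fun i => 2 * beta i) (m n).
pose r n : T n -> R := fun w =>
  (Num.sqrt n%:R)^-1 * \sum_(i < m n) (eps n i w ^+ 2 - 1) - bias n.
have mchi n : measurable_fun setT (fun w => \sum_(i < m n) (eps n i w ^+ 2 - 1)).
  by apply: measurable_sum => i; apply: measurable_funB => //; exact: measurable_funX.
(* Bound on the second moment of r n, from (x - y)^2 <= 2 x^2 + 2 y^2. *)
pose v n : R := 2 * (c4 - 1) * ((m n)%:R / n%:R) + 2 * bias n ^+ 2.
exists (4 * theta beta); split.
- by rewrite mulr_ge0.
- by move=> n n0; exact: inv_semiparametric_info.
apply: (@cvg_to_centered_normal_perturb _ _ _ P _ G r (4 * theta beta) _ v).
- by move=> n; exact: measurable_lin_comb.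
- move=> n; apply: measurable_funB; last exact: measurable_cst.
  by apply: measurable_funM => //; exact: measurable_cst.
- near=> n => w; rewrite theta_hat_decomposition//.
  by near: n; exact: nbhs_infty_gt.
- move=> n; rewrite integral_sqr_lin_comb// sumE lee_fin ler_pM2l//.
  exact: (theta_ge_partial a12).
- near=> n; have n0 : (0 < n)%N by near: n; exact: nbhs_infty_gt.
  have mchi2 : measurable_fun setT (fun w => ((\sum_(i < m n) (eps n i w ^+ 2 - 1)) ^+ 2)%:E).
    by apply/measurable_EFinP; exact: measurable_funX.
  apply: (@le_trans _ _ (\int[P n]_w ((2 / n%:R)%:E *
      ((\sum_(i < m n) (eps n i w ^+ 2 - 1)) ^+ 2)%:E + (2 * bias n ^+ 2)%:E))%E).
    apply: ge0_le_integral => //.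
    + by move=> w _; rewrite lee_fin sqr_ge0.
    + apply/measurable_EFinP; apply: measurable_funX; apply: measurable_funB => //.
      exact: measurable_funM.
    + by apply: emeasurable_funD => //; exact: emeasurable_funM.
    + move=> w _; rewrite -EFinM -EFinD lee_fin /r.
      set S := \sum_(i < m n) _; set s := Num.sqrt n%:R.
      have -> : 2 / n%:R * S ^+ 2 = 2 * (s^-1 * S) ^+ 2.
        by rewrite exprMn exprVn /s sqr_sqrtr// [RHS]mulrA.
      have := sqr_ge0 (s^-1 * S + bias n); nra.
  rewrite ge0_integralD//; last 3 first.
  + by move=> w _; rewrite mule_ge0// lee_fin ?divr_ge0// sqr_ge0.
  + exact: emeasurable_funM.
  + by move=> w _; rewrite lee_fin mulr_ge0// sqr_ge0.
  rewrite ge0_integralZl//; last by move=> w _; rewrite lee_fin sqr_ge0.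
  rewrite integral_sqr_centered_chi_square// integral_cst//= probability_setT mule1.
  rewrite -EFinM -EFinD lee_fin lerD2r le_eqVlt; apply/orP; left; apply/eqP.
  by rewrite /c4; ring.
- rewrite -[X in _ --> X](_ : 2 * (c4 - 1) * 0 + 2 * 0 ^+ 2 = 0); last by ring.
  apply: cvgD; first by apply: cvgM; [exact: cvg_cst|exact: hm2].
  apply: cvgM; first exact: cvg_cst.
  by apply: (cvg_comp bias (fun x => x ^+ 2)); [exact: bias0|exact: exprn_continuous].
- move=> f cf [M fM].
  under eq_fun do rewrite (integral_lin_comb_bounded _ _ (heps _) cf fM) sumE.
  apply: (cvg_integral_normal_scale
    (s_ := fun n => Num.sqrt (4 * \sum_(i < m n) beta i ^+ 2)) cf fM).
  apply: (cvg_comp (fun n => 4 * \sum_(i < m n) beta i ^+ 2) Num.sqrt); last exact: sqrt_continuous.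
  by apply: cvgM; [exact: cvg_cst|exact: (cvg_partial_sum a12 hbeta hm1)].
Unshelve. all: by end_near.
Qed.
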